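(* Let $p$ be a prime with $p\equiv1\pmod4$, and write $p=a^2+b^2$ with $a,b\in\mathbb Z$ and $a\equiv1\pmod4$. Then $$\sum_{k=0}^{\frac{p-1}4}\frac{\binom{4k}{2k}^2}{16^{2k}}\equiv\frac12+(-1)^{\frac{p-1}4}a-(-1)^{\frac{p-1}4}\frac p{4a}\pmod{p^2}.$$
   Context: Congruences are between rational numbers whose denominators are prime to $p$. *)

(* Defs.v *)
From HB Require Import structures.
From mathcomp Require Import all_boot all_order all_algebra.
Set Implicit Arguments. Unset Strict Implicit. Unset Printing Implicit Defensive.
Import Order.TTheory GRing.Theory Num.Theory.
Local Open Scope ring_scope.

Definition rat_eqmod (p k : nat) (x y : rat) : Prop :=
  exists r : rat, x - y = (p ^ k)%N%:R * r /\ ~~ (p%:Z %| denq r)%Z.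

(* Main.v *)
Require Import Defs.
From HB Require Import structures.
From mathcomp Require Import all_boot all_order all_algebra.
From mathcomp Require Import cyclic finfield zify ring.
Import Order.TTheory GRing.Theory Num.Theory.
Local Open Scope ring_scope.
Set Implicit Arguments.
Unset Strict Implicit.
Unset Printing Implicit Defensive.

(** Write [p = 4n+1], [m = 2n] and [C = 'C(2n, n)].  Modulo [p^2] the summand
    ['C(2k,k)^2 / 16^k] is [(-1)^k 'C(m,k) 'C(m+k,k)], so the sum over even indices is
    [(1 + D) / 2] with [D = \sum_k 'C(m,k) 'C(m+k,k)] a central Delannoy number.  As
    [-m-1 = m-p], a second difference gives
    [(-1)^k 'C(m+k,k) + 'C(m+p,k) = 2 'C(m,k)] modulo [p^2], and Kummer-type sums turn this
    into [D = (-1)^n C + p W / 2] with [W = \sum_(k < n) (-1)^k 'C(2n,k) / (n-k)].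
    On the other side, the character sum [A = \sum_x phi(x (x^2 - 1))] over [F_p], expanded
    with Teichmueller representatives modulo [p^2], is
    [(p-1) (-1)^n \sum_(l < p) 'C(pm, n + ml)], which works out to
    [- (-1)^n (C + (-1)^n p W / 2 + p / C)]: the same [W] appears.  Jacobsthal's identity
    [A(1)^2 + A(g)^2 = 4p] and a count modulo 8 give [A = -2 (-1)^n a], and hence
    [(-1)^n D = 2a - p / C] with [C = 2a] modulo [p]. *)

(** * Congruences between p-integral rationals *)

(** The localization of the integers at [p]. As a subring predicate it lets the [rpred] lemmas
    discharge integrality side conditions. *)
Definition plocal (p : nat) : {pred rat} := [pred x | coprimez p (denq x)].

Lemma denq_dvd (x : rat) (d : int) : d%:~R * x \is a Num.int -> (denq x %| d)%Z.
Proof.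
move=> /intrP [z Hz].
have E : d * numq x = z * denq x.
  apply: (@intr_inj rat); rewrite !rmorphM /= -Hz -mulrA numqE; congr (_ * _).
have : (denq x %| d * numq x)%Z by rewrite E dvdz_mull.
by rewrite Gauss_dvdzl // /coprimez gcdzC; apply: coprime_num_den.
Qed.

(** Any denominator prime to [p] is a witness, reduced or not, so closure under the ring operations
    needs only products of denominators. *)
Lemma plocalP (p : nat) (x : rat) :
  reflect (exists2 d : int, coprimez p d & d%:~R * x \is a Num.int) (x \in plocal p).
Proof.
apply: (iffP idP) => [|[d Hd /denq_dvd /dvdzP[q Eq]]].
  by rewrite inE => H; exists (denq x) => //; rewrite mulrC -numqE.
by move: Hd; rewrite inE Eq coprimezMr => /andP[].
Qed.

Fact plocal_subring (p : nat) : subring_closed (plocal p).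
Proof.
split=> [|x y /plocalP[d Hd Hx] /plocalP[e He Hy]|x y /plocalP[d Hd Hx] /plocalP[e He Hy]];
  apply/plocalP.
- by exists 1; [rewrite coprimezE coprimen1 | rewrite mulr1z mul1r rpred1].
- exists (d * e); first by rewrite coprimezMr Hd.
  have -> : (d * e)%:~R * (x - y) = e%:~R * (d%:~R * x) - d%:~R * (e%:~R * y) :> rat
    by rewrite rmorphM /=; ring.
  by apply: rpredB; apply: rpredM => //; apply: intr_int.
- exists (d * e); first by rewrite coprimezMr Hd.
  have -> : (d * e)%:~R * (x * y) = (d%:~R * x) * (e%:~R * y) :> rat
    by rewrite rmorphM /=; ring.
  by apply: rpredM.
Qed.

HB.instance Definition _ p :=
  GRing.isSubringClosed.Build rat (plocal p) (plocal_subring p).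

Lemma plocal_int (p : nat) (z : int) : z%:~R \in plocal p.
Proof. by rewrite rpred_int. Qed.

Lemma plocal_nat (p k : nat) : k%:R \in plocal p.
Proof. by rewrite rpred_nat. Qed.

Lemma plocalVn (p k : nat) : prime p -> ~~ (p %| k)%N -> k%:R^-1 \in plocal p.
Proof.
move=> pp Hk; apply/plocalP; exists k%:Z.
  by rewrite coprimezE /= prime_coprime.
rewrite mulfV ?rpred1 //.
by rewrite pnatr_eq0; apply: contraNneq Hk => ->.
Qed.

Definition eqm (p k : nat) (x y : rat) : bool := (x - y) / (p ^ k)%N%:R \in plocal p.

Lemma eqm_rat_eqmod (p k : nat) (x y : rat) :
  prime p -> eqm p k x y -> rat_eqmod p k x y.
Proof.
move=> pp H; exists ((x - y) / (p ^ k)%N%:R); split.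
  by rewrite mulrC divfK // pnatr_eq0 expn_eq0 negb_and -lt0n prime_gt0.
by move: H; rewrite /eqm inE coprimezE prime_coprime.
Qed.

Section Congruence.
Variables (p : nat) (pp : prime p).

Let pN0 k : (p ^ k)%N%:R != 0 :> rat.
Proof. by rewrite pnatr_eq0 expn_eq0 negb_and -lt0n prime_gt0. Qed.

Lemma eqm_exP k x y :
  reflect (exists2 r, r \in plocal p & x = y + (p ^ k)%N%:R * r) (eqm p k x y).
Proof.
apply: (iffP idP) => [H|[r Hr ->]].
  by exists ((x - y) / (p ^ k)%N%:R) => //; rewrite mulrC divfK // addrC subrK.
by rewrite /eqm addrC addKr mulrC mulKf.
Qed.

Lemma eqm_refl k x : eqm p k x x.
Proof. by rewrite /eqm subrr mul0r rpred0. Qed.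

Lemma eqm_sym k x y : eqm p k x y -> eqm p k y x.
Proof. by rewrite /eqm -(opprB x y) mulNr rpredN. Qed.

Lemma eqm_trans k y x z : eqm p k x y -> eqm p k y z -> eqm p k x z.
Proof.
rewrite /eqm => H1 H2.
have -> : x - z = (x - y) + (y - z) by ring.
by rewrite mulrDl rpredD.
Qed.

Lemma eqmD k x y x' y' : eqm p k x y -> eqm p k x' y' -> eqm p k (x + x') (y + y').
Proof.
rewrite /eqm => H1 H2.
have -> : x + x' - (y + y') = (x - y) + (x' - y') by ring.
by rewrite mulrDl rpredD.
Qed.

Lemma eqmN k x y : eqm p k x y -> eqm p k (- x) (- y).
Proof.
move=> H; rewrite /eqm; have -> : - x - - y = - (x - y) by ring.
by rewrite mulNr rpredN.
Qed.

Lemma eqmB k x y x' y' : eqm p k x y -> eqm p k x' y' -> eqm p k (x - x') (y - y').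
Proof. by move=> H /eqmN; apply: eqmD. Qed.

Lemma eqmMl k c x y : c \in plocal p -> eqm p k x y -> eqm p k (c * x) (c * y).
Proof. by rewrite /eqm -mulrBr -mulrA; apply: rpredM. Qed.

Lemma eqmMr k c x y : c \in plocal p -> eqm p k x y -> eqm p k (x * c) (y * c).
Proof. by rewrite ![_ * c]mulrC; apply: eqmMl. Qed.

Lemma eqmM k x y x' y' : x' \in plocal p -> y \in plocal p ->
  eqm p k x y -> eqm p k x' y' -> eqm p k (x * x') (y * y').
Proof. by move=> Hx' Hy /(eqmMr Hx') H1 /(eqmMl Hy); apply: eqm_trans. Qed.

Lemma eqm_sum k (I : Type) (r : seq I) (P : pred I) (F G : I -> rat) :
  (forall i, P i -> eqm p k (F i) (G i)) ->
  eqm p k (\sum_(i <- r | P i) F i) (\sum_(i <- r | P i) G i).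
Proof.
by move=> H; apply: (big_ind2 (eqm p k)) => // [|*]; [exact: eqm_refl | exact: eqmD].
Qed.

Lemma eqm_sum0 k (I : Type) (r : seq I) (P : pred I) (F : I -> rat) :
  (forall i, P i -> eqm p k (F i) 0) -> eqm p k (\sum_(i <- r | P i) F i) 0.
Proof.
move=> H; apply: (big_ind (fun x => eqm p k x 0)) => // [|x y Hx Hy]; first exact: eqm_refl.
by have := eqmD Hx Hy; rewrite addr0.
Qed.

Lemma eqm_plocal k x y : eqm p k x y -> y \in plocal p -> x \in plocal p.
Proof. by case/eqm_exP => r Hr -> Hy; rewrite rpredD ?rpredM ?plocal_nat. Qed.

Lemma eqmV k x y : x^-1 \in plocal p -> y^-1 \in plocal p -> x != 0 -> y != 0 ->
  eqm p k x y -> eqm p k x^-1 y^-1.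
Proof.
move=> Hx Hy x0 y0 /eqm_sym H.
have := eqmMr (c := x^-1 * y^-1) _ H; rewrite rpredM // => /(_ isT).
have -> : y * (x^-1 * y^-1) = x^-1 by field; rewrite ?x0 ?y0.
by have -> : x * (x^-1 * y^-1) = y^-1 by field; rewrite ?x0 ?y0.
Qed.

Lemma eqmW x y : eqm p 2 x y -> eqm p 1 x y.
Proof.
case/eqm_exP => r Hr ->; apply/eqm_exP; exists (p%:R * r).
  by rewrite rpredM ?plocal_nat.
by rewrite expn1 -mulnn natrM mulrA.
Qed.

(** An explicit factor [p] raises precision by one: cofactors of [p] need only be known modulo
    [p]. *)
Lemma eqm_pM x y : eqm p 1 x y -> eqm p 2 (p%:R * x) (p%:R * y).
Proof.
case/eqm_exP => r Hr ->; apply/eqm_exP; exists r => //.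
by rewrite expn1 -mulnn natrM; ring.
Qed.

Lemma eqm_int k (a b : int) : (p%:Z ^+ k %| a - b)%Z -> eqm p k a%:~R b%:~R.
Proof.
case/dvdzP => q E; apply/eqm_exP; exists q%:~R; first exact: plocal_int.
have -> : a = b + p%:Z ^+ k * q by rewrite [_ * q]mulrC -E; ring.
by rewrite rmorphD rmorphM rmorphXn /= natrX.
Qed.

Lemma eqm_nat k (a b : nat) : a = b %[mod p ^ k] -> eqm p k a%:R b%:R.
Proof.
move=> E; rewrite -[a%:R]/(a%:Z%:~R) -[b%:R]/(b%:Z%:~R); apply: eqm_int.
rewrite -rmorphXn /=  -eqz_mod_dvd. 
by apply/eqP; rewrite !modz_nat E.
Qed.

Lemma eqm0_nat k (a : nat) : (p ^ k %| a)%N -> eqm p k a%:R 0.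
Proof. by move=> H; apply: (@eqm_nat k a 0); rewrite mod0n; apply/eqP. Qed.

Lemma eqm1_dvd (a : nat) : eqm p 1 a%:R 0 -> (p %| a)%N.
Proof.
case/eqm_exP => r /plocalP[d Hd /intrP[z Hz]]; rewrite add0r expn1 => E.
have : (p%:Z %| d * a%:Z)%Z.
  apply/dvdzP; exists z; apply: (@intr_inj rat); rewrite !rmorphM /= -Hz.
  by rewrite -[a%:~R]/(a%:R) E /=; ring.
by rewrite Gauss_dvdzr.
Qed.

End Congruence.

(** * Binomial sums and the Delannoy number *)

Lemma coef_1DcX (R : comNzRingType) (c : R) (n i : nat) :
  ((1 + c *: 'X) ^+ n : {poly R})`_i = c ^+ i * 'C(n, i)%:R.
Proof.
elim: n i => [|n IH] [|i].
- by rewrite expr0 coef1 bin0 mulr1.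
- by rewrite expr0 coef1 bin0n mulr0.
- by rewrite exprS mulrDl mul1r -scalerAl mulrC coefD coefZ coefMX /= mulr0 addr0 IH !bin0.
- rewrite exprS mulrDl mul1r -scalerAl mulrC coefD coefZ coefMX /= !IH binS natrD.
  by rewrite exprS; ring.
Qed.

(** Compare coefficients of X^m in (1-X)^(m+j) (1+X)^m = (1-X^2)^m (1-X)^j. *)
Lemma sum_alt_bin_mul (m j : nat) :
  \sum_(i < m.+1) (-1) ^+ i * 'C(m + j, i)%:R * 'C(m, m - i)%:R =
  \sum_(k < m.+1 | (k.*2 <= m)%N) (-1) ^+ (k + m) * 'C(m, k)%:R * 'C(j, m - k.*2)%:R :> rat.
Proof.
have E : (1 + (-1) *: 'X) ^+ (m + j) * (1 + 1 *: 'X) ^+ m =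
         (\sum_(k < m.+1) 'X^(k.*2) *+ 'C(m, k) * ((-1) ^+ k)%:P) * (1 + (-1) *: 'X) ^+ j :> {poly rat}.
  rewrite exprD mulrAC -exprMn; congr (_ * _).
  have -> : (1 + -1 *: 'X) * (1 + 1 *: 'X) = 1 + - 'X^2 :> {poly rat}.
    by rewrite scale1r scaleN1r; ring.
  rewrite exprDn; apply: eq_bigr => k _.
  rewrite expr1n mul1r (exprNn 'X^2) -exprM mul2n mulrnAl mulrC.
  by rewrite rmorphXn /= rmorphN1.
have := congr1 (fun q : {poly rat} => q`_m) E.
rewrite coefM (eq_bigr (fun i : 'I_m.+1 => (-1) ^+ i * 'C(m + j, i)%:R * 'C(m, m - i)%:R)); last first.
  by move=> i _; rewrite !coef_1DcX expr1n mul1r.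
move=> L; rewrite L mulr_suml coef_sum [RHS]big_mkcond; apply: eq_bigr => k _.
rewrite [_ *+ _ * _%:P]mulrC -[_ * _ * _ ^+ j]mulrA coefCM mulrnAl coefMn [_ * _ ^+ j]mulrC coefMXn.
rewrite ltnNge; case: leqP => //= [h|]; last by rewrite mul0rn mulr0.
rewrite coef_1DcX -[_ *+ 'C(m, k)]mulr_natr.
have -> : (-1) ^+ (m - k.*2) = (-1) ^+ m :> rat.
  by rewrite -signr_odd oddB // odd_double addbF signr_odd.
by rewrite exprD; ring.
Qed.

(** Coefficient of X^m in (1+X)^m (1-(1+X))^m = (1+X)^m (-X)^m, with the second factor expanded in
    powers of 1+X. *)
Lemma sum_alt_bin_shift (m : nat) :
  \sum_(i < m.+1) (-1) ^+ i * 'C(m, i)%:R * 'C(m + i, i)%:R = (-1) ^+ m :> rat.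
Proof.
have E : \sum_(i < m.+1) (((-1) ^+ i)%:P * (1 + 1 *: 'X) ^+ (m + i)) *+ 'C(m, i) =
         (1 + 1 *: 'X) ^+ m * (-1) ^+ m * 'X^m :> {poly rat}.
  rewrite -mulrA -exprMn mulN1r.
  have -> : - 'X = 1 + - (1 + 1 *: 'X) :> {poly rat} by rewrite scale1r; ring.
  rewrite (exprDn 1 (- (1 + _))) mulr_sumr; apply: eq_bigr => k _.
  rewrite expr1n mul1r (exprNn (1 + _)) exprD mulrnAr; congr (_ *+ _).
  by rewrite [((-1) ^+ k)%:P]rmorphXn /= rmorphN1; ring.
have := congr1 (fun q : {poly rat} => q`_m) E.
have -> : (-1) ^+ m = ((-1) ^+ m)%:P :> {poly rat} by rewrite rmorphXn /= rmorphN1.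
rewrite coefMXn ltnn subnn coefMC coef_1DcX bin0 expr0 !mul1r => <-.
rewrite coef_sum; apply: eq_bigr => i _.
rewrite coefMn coefCM coef_1DcX expr1n -[_ *+ 'C(m, i)]mulr_natr.
have -> : 'C(m + i, m) = 'C(m + i, i) by rewrite -(bin_sub (leq_addl m i)) addnK.
by ring.
Qed.

Lemma ffact_rat (a k : nat) : (a ^_ k)%:R = \prod_(j < k) (a%:R - j%:R) :> rat.
Proof.
elim: k => [|k IH]; first by rewrite big_ord0.
rewrite big_ord_recr /= -IH ffactnSr natrM.
case: (leqP k a) => h; first by rewrite natrB.
by rewrite ffact_small // !mul0r.
Qed.

(** Reflection: the product (a+1)...(a+k) is, up to sign, the falling factorial polynomial at
    -a-1. *)
Lemma ffact_shift_rat (a k : nat) :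
  ((a + k) ^_ k)%:R = (-1) ^+ k * \prod_(j < k) (- a.+1%:R - j%:R) :> rat.
Proof.
elim: k => [|k IH]; first by rewrite big_ord0 mulr1.
rewrite big_ord_recr /= addnS ffactSS natrM IH exprS.
by rewrite -!natr1 !natrD; ring.
Qed.

Section BinomialCongruences.
Variables (p m : nat) (pp : prime p) (pE : p = m.*2.+1).

Let pm : (p%:R : rat) = m%:R * 2 + 1.
Proof. by rewrite pE -natr1 -muln2 natrM. Qed.

(** Induction on [k] through ratios of consecutive terms, (2k+1)^2 / (4(k+1)^2) against
    -(m-k)(m+k+1) / (k+1)^2. They differ by exactly p^2 / (4(k+1)^2), since (2k+1)^2 + 4(m-k)(m+k+1)
    = (2m+1)^2. *)
Lemma sqr_bin_mid_eqm (k : nat) : (k <= m)%N ->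
  eqm p 2 ('C(k.*2, k)%:R ^+ 2 / 16 ^+ k) ((-1) ^+ k * 'C(m, k)%:R * 'C(m + k, k)%:R).
Proof.
elim: k => [|k IH] km; first by rewrite !bin0 /eqm (_ : _ - _ = 0) ?mul0r ?rpred0 //; field.
have {}IH := IH (ltnW km).
have k0 : k.+1%:R != 0 :> rat by rewrite pnatr_eq0.
have k1 : 1 + k%:R != 0 :> rat by rewrite addrC natr1.
have kp : (k.+1%:R : rat)^-1 \in plocal p by rewrite plocalVn // gtnNdvd //; lia.
have p2 : (2%:R : rat)^-1 \in plocal p by rewrite plocalVn // gtnNdvd //; lia.
have EC (a b : nat) : 'C(a.+1, b.+1)%:R = a.+1%:R * 'C(a, b)%:R / b.+1%:R :> rat.
  apply: (canRL (mulfK _)); first by rewrite pnatr_eq0.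
  by rewrite -!natrM mulnC mul_bin_diag.
have E0 : 'C(m, k.+1)%:R = 'C(m, k)%:R * (m%:R - k%:R) / k.+1%:R :> rat.
  apply: (canRL (mulfK _)) => //.
  by rewrite -natrB ?(ltnW km) // -!natrM mulnC mul_bin_left mulnC.
have E1 : 'C(m + k.+1, k.+1)%:R = 'C(m + k, k)%:R * (m%:R + k.+1%:R) / k.+1%:R :> rat.
  by rewrite addnS EC -addnS natrD [_ * 'C(_, _)%:R]mulrC.
have E2 : 'C(k.+1.*2, k.+1)%:R = 'C(k.*2, k)%:R * (2 * (k%:R * 2 + 1)) / k.+1%:R :> rat.
  have h : 'C(k.*2.+1, k)%:R = 'C(k.*2, k)%:R * (k%:R*2 + 1) / k.+1%:R :> rat.
    apply: (canRL (mulfK _)) => //.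
    have -> : k%:R * 2 + 1 = k.*2.+1%:R :> rat by rewrite -[RHS]natr1 -muln2 natrM.
    rewrite -!natrM; congr (_%:R).
    have := mul_bin_down k.*2.+1 k; rewrite /= (_ : k.*2.+1 - k = k.+1)%N; last lia.
    by rewrite mulnC [RHS]mulnC => ->.
  have e : k.*2.+2%:R = 2 * k.+1%:R :> rat by rewrite -doubleS -mul2n natrM.
  by rewrite doubleS EC e h; field; rewrite k1.
have -> : 'C(k.+1.*2, k.+1)%:R ^+ 2 / 16 ^+ k.+1 =
  ('C(k.*2, k)%:R ^+ 2 / 16 ^+ k) * ((k%:R * 2 + 1) * 2^-1 / k.+1%:R) ^+ 2 :> rat.
  have t0 : 16 ^+ k != 0 :> rat by rewrite expf_neq0.
  by rewrite E2 [16 ^+ k.+1]exprS; field; rewrite k1 t0.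
have -> : (-1) ^+ k.+1 * 'C(m, k.+1)%:R * 'C(m + k.+1, k.+1)%:R =
  (-1) ^+ k * 'C(m, k)%:R * 'C(m + k, k)%:R *
    (- ((m%:R - k%:R) * (m%:R + k.+1%:R)) / k.+1%:R ^+ 2) :> rat.
  by rewrite E0 E1 exprS; field; rewrite k1.
apply: eqmM => //.
- by rewrite rpredX // rpredM // rpredM // rpredD ?rpredM ?rpred_nat ?rpred1.
- by rewrite !rpredM ?rpred_nat // rpredX // rpredN1.
apply/eqm_exP => //; exists (2^-1 ^+ 2 / k.+1%:R ^+ 2).
  by rewrite -exprVn rpredM // rpredX.
rewrite natrX pm -natr1; field; by rewrite k1.
Qed.

(** First-order Taylor expansion of the falling factorial at [y]: [e] is its derivative, built by
    the product rule. The same [e] serves both shifts, so it cancels in the second difference. *)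
Lemma prod_second_diff (y : int) (k : nat) : exists e : rat, e \in plocal p /\
  (eqm p 2 (\prod_(j < k) (y%:~R + p%:R - j%:R)) (\prod_(j < k) (y%:~R - j%:R) + p%:R * e)) /\
  (eqm p 2 (\prod_(j < k) (y%:~R - p%:R - j%:R)) (\prod_(j < k) (y%:~R - j%:R) - p%:R * e)).
Proof.
elim: k => [|k [e [He [H1 H2]]]].
  exists 0; split; first exact: rpred0.
  by split; rewrite !big_ord0 mulr0 ?addr0 ?subr0 eqm_refl.
set P := \prod_(j < k) (y%:~R - j%:R) in H1 H2.
have HP : P \in plocal p by apply: rpred_prod => i _; apply: rpredB; rewrite ?plocal_int ?plocal_nat.
have Hy : y%:~R - k%:R \in plocal p by apply: rpredB; rewrite ?plocal_int ?plocal_nat.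
exists (P + e * (y%:~R - k%:R)); split; first by rewrite rpredD // rpredM.
rewrite !big_ord_recr /= -/P; split.
- apply: eqm_trans (eqmMr _ H1) _; first by rewrite addrAC rpredD ?plocal_nat.
  by apply/eqm_exP => //; exists e => //; rewrite natrX; ring.
- apply: eqm_trans (eqmMr _ H2) _; first by rewrite addrAC rpredB ?plocal_nat.
  by apply/eqm_exP => //; exists e => //; rewrite natrX; ring.
Qed.

(* Since [p = 2m+1], [(-1)^k 'C(m+k,k)] is the binomial polynomial [y choose k] at [m - p]. *)
Lemma bin_second_diff (k : nat) : (k <= m)%N ->
  eqm p 2 ((-1) ^+ k * 'C(m + k, k)%:R) (2 * 'C(m, k)%:R - 'C(m + p, k)%:R).
Proof.
move=> km.
have k0 : (k`!)%:R != 0 :> rat by rewrite pnatr_eq0 -lt0n fact_gt0.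
have kp : ((k`!)%:R : rat)^-1 \in plocal p.
  rewrite plocalVn //; elim: {1 3}k (leqnn k) => [|i IH] ik; first by rewrite fact0 gtnNdvd ?prime_gt1.
  by rewrite factS Euclid_dvdM // negb_or IH ?(ltnW ik) // gtnNdvd //; lia.
have EC a : 'C(a, k)%:R = (a ^_ k)%:R / (k`!)%:R :> rat.
  by rewrite -bin_ffact natrM mulfK.
rewrite !EC ffact_shift_rat !ffact_rat !mulrA -mulrBl.
apply: eqmMr => //; rewrite -exprD addnn -signr_odd odd_double expr0 mul1r.
have [e [He [H1 H2]]] := prod_second_diff m%:Z k.
have E1 : \prod_(j < k) (- m.+1%:R - j%:R) = \prod_(j < k) (m%:~R - p%:R - j%:R) :> rat.
  by apply: eq_bigr => j _; rewrite pm -natr1; ring.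
have E2 : \prod_(j < k) ((m + p)%:R - j%:R) = \prod_(j < k) (m%:~R + p%:R - j%:R) :> rat.
  by apply: eq_bigr => j _; rewrite natrD.
rewrite E1 E2; apply: eqm_trans H2 _; apply: eqm_sym.
apply: eqm_trans (eqmB (eqm_refl _ _ _) H1) _.
set P := \prod_(j < k) (m%:R - j%:R).
have -> : 2 * P - (P + p%:R * e) = P - p%:R * e by ring.
exact: eqm_refl.
Qed.

End BinomialCongruences.

(** * Binomial coefficients with upper index a multiple of p *)

Section BinomialsModPrime.
Variables (p : nat) (pp : prime p).

Lemma dvdn_bin_mul (M j : nat) : ~~ (p %| j)%N -> (p %| 'C(p * M, j))%N.
Proof.
case: j => [|j]; first by rewrite dvdn0.
move=> pj; rewrite -(@Gauss_dvdr p j.+1) ?prime_coprime // -mul_bin_diag.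
by rewrite -mulnA dvdn_mulr.
Qed.

(** Vandermonde splits off a block of size [p]. The terms i = 0 and i = p reproduce Pascal's rule;
    for 0 < i < p both factors are divisible by [p]. *)
Lemma bin_mul_mul_eqm (M k : nat) : eqm p 2 'C(p * M, p * k)%:R 'C(M, k)%:R.
Proof.
have p0 := prime_gt0 pp.
elim: M k => [|M IH] [|k].
- by rewrite !muln0 bin0 eqm_refl.
- by rewrite muln0 !bin0n muln_eq0 eqn0Ngt p0 eqm_refl.
- by rewrite muln0 !bin0 eqm_refl.
rewrite [in (p * M.+1)%N]mulnS -binomial.Vandermonde natr_sum.
have e : (p * k.+1 - p = p * k)%N by rewrite mulnS addKn.
have hp : (p < (p * k.+1).+1)%N by rewrite ltnS leq_pmulr.
rewrite (bigD1 ord0) //= (bigD1 (Ordinal hp)) /=; last by rewrite -val_eqE /= -lt0n.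
rewrite bin0 mul1n binn mul1n subn0 e addrA.
rewrite binS natrD -[X in eqm _ _ _ X]addr0; apply: eqmD => //; first by apply: eqmD.
apply: eqm_sum0 => // i /andP[i0 ip]; apply: eqm0_nat => //.
rewrite -!val_eqE /= in i0 ip.
have [|pi] := leqP p i.
  rewrite leq_eqVlt eq_sym (negPf ip) => /= h.
  by rewrite bin_small ?mul0n.
have ni : ~~ (p %| i)%N by rewrite gtnNdvd // lt0n.
rewrite -mulnn dvdn_mul //; first by rewrite -[p in 'C(p, _)]muln1 dvdn_bin_mul.
apply: dvdn_bin_mul; rewrite dvdn_subr ?dvdn_mulr //.
by have := ltn_ord i; rewrite ltnS.
Qed.

(** Induction on [r]: by Pascal's rule two consecutive entries sum to 'C(p(M+1), ps+r+1), which [p]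
    divides, so the sign alternates. The case r = 0 reduces to [bin_mul_mul_eqm] by absorption. *)
Lemma bin_pred_eqm (M s r : nat) : ~~ (p %| M.+1)%N -> (r < p)%N ->
  eqm p 1 'C((p * M.+1).-1, p * s + r)%:R ((-1) ^+ r * 'C(M, s)%:R).
Proof.
move=> pM; have p0 := prime_gt0 pp; have M0 : M.+1%:R != 0 :> rat by rewrite pnatr_eq0.
have MV : (M.+1%:R : rat)^-1 \in plocal p by rewrite plocalVn.
have pM0 : (0 < p * M.+1)%N by rewrite muln_gt0 p0.
elim: r => [|r IH] rp.
  rewrite addn0 mul1r.
  have E : M.+1%:R * 'C((p * M.+1).-1, p * s)%:R = (M.+1 - s)%:R * 'C(p * M.+1, p * s)%:R :> rat.
    rewrite -!natrM; congr (_%:R); apply/eqP; rewrite -(eqn_pmul2l p0) !mulnA mulnBr.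
    by rewrite mul_bin_down.
  have F : M.+1%:R * 'C(M, s)%:R = (M.+1 - s)%:R * 'C(M.+1, s)%:R :> rat.
    by rewrite -!natrM -mul_bin_down.
  rewrite -[X in eqm _ _ X](mulKf M0) -[X in eqm _ _ _ X](mulKf M0) E F.
  apply: eqmMl => //; apply: eqmMl; first exact: plocal_nat.
  by apply: eqmW => //; apply: bin_mul_mul_eqm.
have {}IH := IH (ltnW rp).
have -> : 'C((p * M.+1).-1, p * s + r.+1)%:R =
          'C(p * M.+1, p * s + r.+1)%:R - 'C((p * M.+1).-1, p * s + r)%:R :> rat.
  rewrite addnS -[in 'C(p * M.+1, _)](prednK pM0) binS natrD; ring.
have -> : (-1) ^+ r.+1 * 'C(M, s)%:R = 0 - (-1) ^+ r * 'C(M, s)%:R :> rat by rewrite exprS; ring.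
apply: eqmB => //; apply: eqm0_nat => //; rewrite expn1 dvdn_bin_mul //.
by rewrite dvdn_addr ?dvdn_mulr // gtnNdvd.
Qed.

(** Absorption extracts the factor p(M+1)/(ps+r); the rest is then needed only modulo [p], where
    ps+r becomes [r]. *)
Lemma bin_off_eqm (M s r : nat) : ~~ (p %| M.+1)%N -> (0 < r < p)%N ->
  eqm p 2 'C(p * M.+1, p * s + r)%:R
          (p%:R * (- M.+1%:R * ((-1) ^+ r * 'C(M, s)%:R) / r%:R)).
Proof.
case: r => // r pM /andP[_ rp].
have nd : ~~ (p %| r.+1)%N by rewrite gtnNdvd.
have nd' : ~~ (p %| p * s + r.+1)%N by rewrite dvdn_addr ?dvdn_mulr.
have e0 : (p * s + r.+1)%:R != 0 :> rat by rewrite pnatr_eq0 addnS.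
have -> : 'C(p * M.+1, p * s + r.+1)%:R =
    p%:R * (M.+1%:R * 'C((p * M.+1).-1, p * s + r)%:R / (p * s + r.+1)%:R) :> rat.
  rewrite !mulrA; apply: (canRL (mulfK e0)).
  by rewrite -!natrM mul_bin_diag addnS mulnC.
apply: eqm_pM => //; apply: eqmM.
- by rewrite plocalVn.
- by rewrite rpredM ?rpredN ?rpred_nat // rpredM ?rpred_nat // rpredX // rpredN1.
- rewrite mulNr -mulrN; apply: eqmMl; first exact: plocal_nat.
  rewrite exprS mulN1r mulNr opprK; apply: bin_pred_eqm => //; exact: ltnW.
apply: eqmV => //; rewrite ?plocalVn ?pnatr_eq0 //.
apply/eqm_exP => //; exists s%:R; first exact: plocal_nat.
by rewrite natrD natrM expn1 addrC.
Qed.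

End BinomialsModPrime.

(** * The Delannoy number modulo p^2 *)

Section Delannoy.
Variables (p n : nat) (pp : prime p) (pE : p = (4 * n).+1).

(* The quantity [W] of the header. *)
Definition half_alt_sum (n : nat) : rat :=
  \sum_(k < n) (-1) ^+ k * 'C(n.*2, k)%:R / (n - k)%:R.

Let pm : p = n.*2.*2.+1. Proof. by rewrite pE -!mul2n mulnA. Qed.

Let sgn_double k : (-1) ^+ k.*2 = 1 :> rat.
Proof. by rewrite -signr_odd odd_double. Qed.

(** Case j = 0 of [sum_alt_bin_mul]: 'C(0, 2n-2k) leaves only k = n. *)
Lemma sqr_bin_alt_sum : \sum_(i < n.*2.+1) (-1) ^+ i * 'C(n.*2, i)%:R ^+ 2 =
  (-1) ^+ n * 'C(n.*2, n)%:R :> rat.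
Proof.
have := sum_alt_bin_mul n.*2 0; rewrite addn0 => E.
rewrite (eq_bigr (fun i : 'I_n.*2.+1 => (-1) ^+ i * 'C(n.*2, i)%:R * 'C(n.*2, n.*2 - i)%:R)); last first.
  by move=> i _; rewrite bin_sub ?expr2 ?mulrA // -ltnS.
have hn : (n < n.*2.+1)%N by rewrite ltnS -addnn leq_addr.
rewrite E (bigD1 (Ordinal hn)) //= subnn bin0 mulr1 big1 ?addr0 => [|i /andP[h1 h2]]; last first.
  rewrite bin0n subn_eq0 (_ : (_ <= _)%N = false) ?mulr0 //; apply/negbTE; rewrite -ltnNge.
  rewrite ltn_neqAle h1 andbT; apply: contra h2 => /eqP e.
  by apply/eqP/val_inj/double_inj.
by rewrite exprD sgn_double mulr1.
Qed.

(** Case j = p of [sum_alt_bin_mul]: k = n gives the main term, and for k < n the factor 'C(p,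
    2(n-k)) is -p / (2(n-k)) modulo p^2, which assembles into [half_alt_sum]. *)
Lemma bin_shift_alt_sum_eqm :
  eqm p 2 (\sum_(i < n.*2.+1) (-1) ^+ i * 'C(n.*2, i)%:R * 'C(n.*2 + p, i)%:R)
    ((-1) ^+ n * 'C(n.*2, n)%:R - p%:R * (half_alt_sum n / 2)).
Proof.
have := sum_alt_bin_mul n.*2 p.
rewrite (eq_bigr (fun i : 'I_n.*2.+1 => (-1) ^+ i * 'C(n.*2, i)%:R * 'C(n.*2 + p, i)%:R)); last first.
  by move=> i _; rewrite bin_sub -1?ltnS // mulrAC.
move=> ->.
rewrite (eq_bigl (fun i : 'I_n.*2.+1 => (i < n.+1)%N)); last by move=> i; rewrite leq_double ltnS.
rewrite -(big_ord_widen n.*2.+1 (fun k => (-1) ^+ (k + n.*2) * 'C(n.*2, k)%:R * 'C(p, n.*2 - k.*2)%:R));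
  last by rewrite ltnS -addnn leq_addr.
rewrite big_ord_recr /= subnn bin0 mulr1 addrC.
rewrite exprD sgn_double mulr1.
apply: eqmD; first exact: eqm_refl.
rewrite /half_alt_sum mulr_suml mulr_sumr -sumrN; apply: eqm_sum => k _.
rewrite exprD sgn_double mulr1.
have kn := ltn_ord k; rewrite -doubleB.
have nk : (n - k)%:R != 0 :> rat by rewrite pnatr_eq0 -lt0n subn_gt0.
have := @bin_off_eqm p pp 0 0 (n - k).*2; rewrite muln1 muln0 add0n bin0 => H.
rewrite [X in eqm _ _ _ X](_ : _ = (-1) ^+ k * 'C(n.*2, k)%:R *
   (p%:R * (- 1%:R * ((-1) ^+ (n - k).*2 * 1%:R) / (n - k).*2%:R))).
  apply: eqmMl; first by rewrite rpredM ?rpred_nat // rpredX // rpredN1.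
  by apply: H; [rewrite dvdn1 neq_ltn prime_gt1 ?orbT | lia].
by rewrite sgn_double -[(n - k).*2]muln2 natrM; field; rewrite nk.
Qed.

(** Multiply [bin_second_diff] by (-1)^i 'C(2n, i) and sum: twice [sqr_bin_alt_sum] minus
    [bin_shift_alt_sum_eqm]. *)
Lemma delannoy_eqm :
  eqm p 2 (\sum_(i < n.*2.+1) 'C(n.*2, i)%:R * 'C(n.*2 + i, i)%:R)
    ((-1) ^+ n * 'C(n.*2, n)%:R + p%:R * (half_alt_sum n / 2)).
Proof.
have -> : (-1) ^+ n * 'C(n.*2, n)%:R + p%:R * (half_alt_sum n / 2) =
  2 * ((-1) ^+ n * 'C(n.*2, n)%:R) - ((-1) ^+ n * 'C(n.*2, n)%:R - p%:R * (half_alt_sum n / 2)) by ring.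
apply: eqm_trans (eqmB (eqm_refl _ _ _) bin_shift_alt_sum_eqm).
rewrite -sqr_bin_alt_sum mulr_sumr -sumrB; apply: eqm_sum => i _.
rewrite [X in eqm _ _ X](_ : _ = (-1) ^+ i * 'C(n.*2, i)%:R * ((-1) ^+ i * 'C(n.*2 + i, i)%:R)).
  rewrite [X in eqm _ _ _ X](_ : _ =
    (-1) ^+ i * 'C(n.*2, i)%:R * (2 * 'C(n.*2, i)%:R - 'C(n.*2 + p, i)%:R)); last by ring.
  apply: eqmMl; first by rewrite rpredM ?rpred_nat // rpredX // rpredN1.
  by apply: bin_second_diff => //; rewrite -ltnS.
by rewrite mulrACA -expr2 sqrr_sign mul1r.
Qed.

Lemma sum_even_terms (v : nat -> rat) (k : nat) :
  (\sum_(i < k.*2.+1) (1 + (-1) ^+ i) * v i) / 2 = \sum_(i < k.+1) v i.*2.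
Proof.
elim: k => [|k IH]; first by rewrite !big_ord1 /=; field.
rewrite doubleS big_ord_recr big_ord_recr [RHS]big_ord_recr /= -IH.
by rewrite !exprS sgn_double doubleS; field.
Qed.

Lemma truncated_sum_eqm :
  eqm p 2 (\sum_(0 <= k < n + 1) ('C(4 * k, 2 * k) ^ 2)%N%:R / (16 ^ (2 * k))%N%:R)
    (1 / 2 + (\sum_(i < n.*2.+1) 'C(n.*2, i)%:R * 'C(n.*2 + i, i)%:R) / 2).
Proof.
have -> : 1 / 2 + (\sum_(i < n.*2.+1) 'C(n.*2, i)%:R * 'C(n.*2 + i, i)%:R) / 2 =
   \sum_(k < n.+1) 'C(n.*2, k.*2)%:R * 'C(n.*2 + k.*2, k.*2)%:R :> rat.
  (* The constant 1 is itself the alternating sum of the same terms, so adding it and halving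
     selects the even indices. *)
  have := sum_alt_bin_shift n.*2; rewrite sgn_double => E.
  rewrite -[X in X / 2 + _]E -mulrDl -big_split /=.
  pose v k : rat := 'C(n.*2, k)%:R * 'C(n.*2 + k, k)%:R.
  rewrite -[RHS](sum_even_terms v) /v; congr (_ / _).
  by apply: eq_bigr => i _; ring.
rewrite addn1 big_mkord; apply: eqm_sum => k _.
have := @sqr_bin_mid_eqm p n.*2 pp pm k.*2; rewrite sgn_double mul1r leq_double -ltnS.
move/(_ (ltn_ord k)); rewrite natrX natrX -!mul2n mulnA; exact.
Qed.

End Delannoy.

(** * The binomial expansion of the Jacobi sum *)

(** This is the Beta integral of t^x (1-t)^N over [0,1], expanded binomially. Pascal's rule gives
    S(N+1,x) = S(N,x) - S(N,x+1), whence the induction. *)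
Lemma beta_sum (N x : nat) :
  \sum_(s < N.+1) (-1) ^+ s * 'C(N, s)%:R / (x.+1 + s)%:R =
  (x`!)%:R * (N`!)%:R / ((x + N)%N.+1`!)%:R :> rat.
Proof.
elim: N x => [|N IH] x.
  rewrite big_ord1 bin0 !addn0 fact0 factS natrM.
  have x0 : (x`!)%:R != 0 :> rat by rewrite pnatr_eq0 -lt0n fact_gt0.
  by field; rewrite x0 addrC natr1 pnatr_eq0.
have -> : \sum_(s < N.+2) (-1) ^+ s * 'C(N.+1, s)%:R / (x.+1 + s)%:R =
  \sum_(s < N.+1) (-1) ^+ s * 'C(N, s)%:R / (x.+1 + s)%:R -
  \sum_(s < N.+1) (-1) ^+ s * 'C(N, s)%:R / (x.+2 + s)%:R :> rat.
  rewrite big_ord_recl [X in _ = X - _](_ : _ =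
    \sum_(s < N.+2) (-1) ^+ s * 'C(N, s)%:R / (x.+1 + s)%:R); last first.
    by rewrite [RHS]big_ord_recr /= bin_small // mulr0 mul0r addr0.
  rewrite [in RHS]big_ord_recl /= !bin0 -addrA -sumrB; congr (_ + _).
  apply: eq_bigr => s _; rewrite /bump /= add1n binS natrD exprS addnS addSn.
  by ring.
have fS k : (k.+1`!)%:R = k.+1%:R * (k`!)%:R :> rat by rewrite factS natrM.
rewrite !IH addnS !addSn (fS x) (fS N) (fS (x + N)%N.+1).
have f0 : ((x + N)%N.+1`!)%:R != 0 :> rat by rewrite pnatr_eq0 -lt0n fact_gt0.
have e : (x + N)%N.+2%:R = x%:R + N%:R + 2 :> rat by rewrite -!natrD addn2.
have e0 : x%:R + N%:R + 2 != 0 :> rat by rewrite -e pnatr_eq0.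
by rewrite e; field; rewrite f0.
Qed.

Lemma sum_symmetric (G : nat -> rat) (m : nat) :
  (forall l, (l < m)%N -> G (m.*2 - l)%N = G l) ->
  \sum_(l < m.*2.+1) G l = G m + 2 * \sum_(l < m) G l.
Proof.
move=> HG; rewrite -(big_mkord xpredT) (@big_cat_nat _ _ _ m) //=; last by rewrite -addnn leqW ?leq_addr.
rewrite [X in _ + X]big_ltn ?ltnS -?addnn ?leq_addr // addnn.
rewrite [X in _ + (_ + X)](_ : _ = \sum_(0 <= l < m) G l); first by rewrite !big_mkord; ring.
rewrite -[m.+1]add0n big_addn (_ : (m.*2.+1 - m.+1 = m)%N); last by rewrite subSS -addnn addnK.
rewrite [LHS]big_nat_rev; apply: eq_big_nat => l /andP[_ lm].
by rewrite -(HG l lm); congr G; lia.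
Qed.

Lemma sum_pairs (G : nat -> rat) (k : nat) :
  \sum_(l < k.*2) G l = \sum_(s < k) (G s.*2 + G s.*2.+1).
Proof.
elim: k => [|k IH]; first by rewrite !big_ord0.
by rewrite doubleS !big_ord_recr /= IH addrA.
Qed.

Section JacobiExpansion.
Variables (p n : nat) (pp : prime p) (pE : p = (4 * n).+1).

Let n0 : (0 < n)%N.
Proof. by rewrite lt0n; apply: contraTneq pp => n0; rewrite pE n0. Qed.

Let pm : p = n.*2.*2.+1. Proof. by rewrite pE -!mul2n mulnA. Qed.

Let mE : n.*2.-1.+1 = n.*2. Proof. by rewrite prednK ?double_gt0. Qed.

Let ndvd k : (0 < k < p)%N -> ~~ (p %| k)%N.
Proof. by case/andP=> *; rewrite gtnNdvd. Qed.

(** Here 'C(2n-1, s) = 'C(2n, s) (2n-s)/(2n) and (2n-s)/(n-s) = 1 + n/(n-s). The second part gives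
    half of [half_alt_sum]; the first is half of a vanishing symmetric alternating sum, up to its
    middle term. *)
Lemma half_alt_sum_pred :
  \sum_(s < n) (-1) ^+ s * 'C(n.*2.-1, s)%:R / (n - s)%:R =
  - ((-1) ^+ n * 'C(n.*2, n)%:R / (4 * n%:R)) + half_alt_sum n / 2.
Proof.
have nz : n%:R != 0 :> rat by rewrite pnatr_eq0 -lt0n.
have E : \sum_(s < n) (-1) ^+ s * 'C(n.*2, s)%:R = - ((-1) ^+ n * 'C(n.*2, n)%:R) / 2 :> rat.
  have := sum_symmetric (G := fun s => (-1) ^+ s * 'C(n.*2, s)%:R) (m := n) _.
  have -> : \sum_(l < n.*2.+1) (-1) ^+ l * 'C(n.*2, l)%:R = 0 :> rat.
    rewrite (_ : \sum_(_ < _) _ = (1 - 1) ^+ n.*2); last first.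
      rewrite exprBn; apply: eq_bigr => i _.
      by rewrite !expr1n !mulr1 mulr_natr.
    by rewrite subrr expr0n double_eq0 eqn0Ngt n0.
  move=> H; have {H} := H _; move=> /(_ _)/eqP; rewrite eq_sym addr_eq0 => H.
  have {}H := eqP (H _); rewrite H; first by field.
  move=> l ln; rewrite bin_sub; last by rewrite -addnn ltnW // ltn_addr.
  by rewrite -signr_odd oddB ?odd_double ?signr_odd // -addnn ltnW // ltn_addr.
rewrite [X in _ = X + _](_ : _ = (\sum_(s < n) (-1) ^+ s * 'C(n.*2, s)%:R) / (2 * n%:R)); last first.
  by rewrite E; field; rewrite nz.
rewrite /half_alt_sum !mulr_suml -big_split; apply: eq_bigr => s _ /=.
have sn := ltn_ord s.
have ns : (n - s)%:R = n%:R - s%:R :> rat by rewrite natrB // ltnW.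
have ns0 : n%:R - s%:R != 0 :> rat by rewrite -ns pnatr_eq0 -lt0n subn_gt0.
have -> : 'C(n.*2.-1, s)%:R = 'C(n.*2, s)%:R * (2 * n%:R - s%:R) / (2 * n%:R) :> rat.
  apply: (canRL (mulfK _)); first by rewrite mulf_neq0.
  have -> : 2 * n%:R - s%:R = (n.*2 - s)%:R :> rat.
    by rewrite natrB -?mul2n ?natrM // mul2n -addnn ltnW // ltn_addr.
  by rewrite -natrM mul2n -!natrM mulnC mul_bin_down mulnC.
by rewrite ns; field; rewrite nz ns0.
Qed.

(** Modulo [p], Vandermonde gives 'C(2n+p, n) = 'C(2n, n), so [bin_second_diff] at k = n collapses
    to this. *)
Lemma bin_3n_eqm : eqm p 1 'C(n.*2 + n, n)%:R ((-1) ^+ n * 'C(n.*2, n)%:R).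
Proof.
have H1 : eqm p 1 'C(n.*2 + p, n)%:R 'C(n.*2, n)%:R.
  rewrite addnC -binomial.Vandermonde natr_sum big_ord_recl /= bin0 mul1n subn0.
  rewrite -[X in eqm _ _ _ X]addr0; apply: eqmD; first exact: eqm_refl.
  apply: eqm_sum0 => // i _; apply: eqm0_nat => //; rewrite expn1 dvdn_mulr //.
  rewrite -[p in 'C(p, _)]muln1; apply: dvdn_bin_mul => //; apply: ndvd.
  by rewrite /bump /=; have := ltn_ord i; lia.
have := bin_second_diff pp pm (k := n); rewrite -addnn leq_addr addnn => /(_ isT) /eqmW -/(_ pp) H2.
have {}H2 := eqm_trans H2 (eqmB (eqm_refl _ _ _) H1).
have s1 : (-1) ^+ n \in plocal p by rewrite rpredX // rpredN1.
have := eqmMl s1 H2; rewrite mulrA -expr2 sqrr_sign mul1r.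
by congr eqm; ring.
Qed.

Lemma ndvd_bin_mid : ~~ (p %| 'C(n.*2, n))%N.
Proof.
have : ~~ (p %| n.*2`!)%N.
  have: (n.*2 < p)%N by lia.
  elim: (n.*2) => [|i IH] ip; first by rewrite fact0 gtnNdvd ?prime_gt1.
  by rewrite factS Euclid_dvdM // negb_or IH ?(ltnW ip) // gtnNdvd.
apply: contra => h; rewrite -(@bin_fact n.*2 n) ?dvdn_mulr //.
by rewrite -addnn leq_addr.
Qed.

Let CV : ('C(n.*2, n)%:R : rat)^-1 \in plocal p.
Proof. by rewrite plocalVn // ndvd_bin_mid. Qed.

Let C0 : 'C(n.*2, n)%:R != 0 :> rat.
Proof. by rewrite pnatr_eq0; apply: contraNneq ndvd_bin_mid => ->. Qed.

Let halfV : (2 : rat)^-1 \in plocal p.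
Proof. by rewrite plocalVn // ndvd //; lia. Qed.

Let sgn_local k : (-1) ^+ k \in plocal p.
Proof. by rewrite rpredX // rpredN1. Qed.

Let pQ : p%:R = 4 * n%:R + 1 :> rat.
Proof. by rewrite pE -natr1 natrM. Qed.

Lemma half_alt_sum_plocal : half_alt_sum n \in plocal p.
Proof.
apply: rpred_sum => k _; have := ltn_ord k => kn.
by rewrite rpredM ?rpredM ?rpred_nat // plocalVn // ndvd //; lia.
Qed.

(** The sum is, up to sign, one half of a Beta sum of value 1/(2n 'C(3n, n)) whose two halves agree
    modulo [p]. So it is -1/(4n 'C(3n, n)), that is 1/'C(3n, n) because 4n = -1 modulo [p];
    [bin_3n_eqm] finishes. *)
Lemma far_sum_eqm :
  eqm p 1 (\sum_(s < n) (-1) ^+ s * 'C(n.*2.-1, s)%:R / (3 * n - s)%:R)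
    ((-1) ^+ n / 'C(n.*2, n)%:R).
Proof.
set Y := \sum_(s < n) _.
pose B : rat := \sum_(s < n) (-1) ^+ s * 'C(n.*2.-1, s)%:R / (n.+1 + s)%:R.
(* [B] is the lower half of [beta_sum] with N = 2n-1, x = n. Reversing s to 2n-1-s turns the upper
   half into exactly [- Y]: the sign flips and n+1+s becomes 3n-s. *)
have full : B - Y = ('C(n.*2 + n, n)%:R * (2 * n%:R))^-1.
  have := beta_sum n.*2.-1 n; rewrite -addnS mE.
  rewrite -(big_mkord xpredT (fun s => (-1) ^+ s * 'C(n.*2.-1, s)%:R / (n.+1 + s)%:R)).
  rewrite (@big_cat_nat _ _ _ n) //=; last by rewrite -addnn leq_addr.
  rewrite big_mkord -/B [X in _ + X](_ : _ = - Y) => [->|].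
    have := bin_fact (leq_addl n.*2 n); rewrite addnK => e.
    have fE : (n.*2`! = n.*2 * n.*2.-1`!)%N by rewrite -[in LHS]mE factS mE.
    rewrite [(n + _)%N]addnC -e fE 3!natrM.
    have f0 k : (k`!)%:R != 0 :> rat by rewrite pnatr_eq0 -lt0n fact_gt0.
    have b0 : 'C(n.*2 + n, n)%:R != 0 :> rat by rewrite pnatr_eq0 -lt0n bin_gt0 leq_addl.
    have n0' : n%:R != 0 :> rat by rewrite pnatr_eq0 -lt0n.
    by rewrite -[n.*2]mul2n natrM mul2n; field; rewrite n0' b0 !f0.
  rewrite -[X in \sum_(X <= _ < _) _]add0n big_addn -addnn addnK big_nat_rev big_mkord.
  rewrite /Y -sumrN; apply: eq_bigr => s _; have sn := ltn_ord s.
  rewrite add0n addnn (_ : ((n - s.+1) + n = n.*2.-1 - s)%N) 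
    ?(_ : (n + n.*2 - (s + n).+1 = n.*2.-1 - s)%N); last by lia.
  rewrite bin_sub; last by lia.
  rewrite (_ : (n.+1 + (n.*2.-1 - s) = 3 * n - s)%N); last by lia.
  have -> : (-1) ^+ (n.*2.-1 - s) = - (-1) ^+ s :> rat.
    rewrite -[LHS]signr_odd (_ : odd _ = ~~ odd s); last by lia.
    by rewrite signrN signr_odd.
  by ring.
(* [n+1+s = -(3n-s)] modulo [p = 4n+1], so both halves of the full sum agree. *)
have BY : eqm p 1 B (- Y).
  rewrite /B /Y -sumrN; apply: eqm_sum => s _; have sn := ltn_ord s.
  rewrite -mulrN; apply: eqmMl; first by rewrite rpredM ?rpred_nat.
  have h1 : (3 * n - s)%:R = 3 * n%:R - s%:R :> rat by rewrite natrB ?natrM //; lia.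
  have h2 : (n.+1 + s)%:R = n%:R + 1 + s%:R :> rat by rewrite natrD -natr1.
  have z1 : (3 * n - s)%:R != 0 :> rat by rewrite pnatr_eq0; lia.
  have z2 : (n.+1 + s)%:R != 0 :> rat by rewrite pnatr_eq0; lia.
  apply/eqm_exP => //; exists ((3 * n - s)%:R^-1 / (n.+1 + s)%:R).
    by rewrite rpredM // plocalVn // ndvd //; lia.
  by rewrite expn1 pQ; move: z1 z2; rewrite h1 h2 => z1 z2; field; rewrite z1 z2.
have YE : eqm p 1 Y (- (B - Y) / 2).
  have : eqm p 1 ((Y + Y) / 2) ((Y - B) / 2).
    apply: eqmMr => //; apply: eqmD; first exact: eqm_refl.
    by have := eqmN BY; rewrite opprK => /eqm_sym.
  by rewrite opprB (_ : (Y + Y) / 2 = Y) //; field.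
apply: eqm_trans YE _; rewrite full.
have b0 : 'C(n.*2 + n, n)%:R != 0 :> rat by rewrite pnatr_eq0 -lt0n bin_gt0 leq_addl.
have n0' : n%:R != 0 :> rat by rewrite pnatr_eq0 -lt0n.
have nV : (n%:R : rat)^-1 \in plocal p by rewrite plocalVn // ndvd //; lia.
have bV : ('C(n.*2 + n, n)%:R : rat)^-1 \in plocal p.
  rewrite plocalVn //; apply/negP => h.
  have := eqm0_nat pp (k := 1) (a := 'C(n.*2 + n, n)); rewrite expn1 => /(_ h) /eqm_sym h0.
  have := eqmMl (sgn_local n) (eqm_trans h0 bin_3n_eqm).
  rewrite mulr0 mulrA -expr2 sqrr_sign mul1r => /eqm_sym /(eqm1_dvd pp).
  by apply/negP; exact: ndvd_bin_mid.
have -> : (-1) ^+ n / 'C(n.*2, n)%:R = ((-1) ^+ n * 'C(n.*2, n)%:R)^-1 :> rat.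
  by rewrite invfM -exprVn invrN1.
apply: (@eqm_trans _ _ ('C(n.*2 + n, n)%:R^-1)).
  apply/eqm_exP => //; exists (- ('C(n.*2 + n, n)%:R^-1 / n%:R / 2 / 2)).
    by rewrite rpredN !rpredM.
  by rewrite expn1 pQ; field; rewrite b0 n0'.
apply: eqmV => //; last exact: bin_3n_eqm.
  by rewrite invfM rpredM // -exprVn invrN1.
by rewrite mulf_neq0 // expf_neq0.
Qed.

(** The terms are symmetric under l to 4n-l, with middle term 'C(2pn, pn). For l < 2n the lower
    index is ps+(n-s) if l = 2s and ps+(3n-s) if l = 2s+1, so [bin_off_eqm] yields the sums of
    [half_alt_sum_pred] and [far_sum_eqm]. *)
Lemma jacobi_sum_eqm :
  eqm p 2 (\sum_(l < p) 'C(p * n.*2, n + n.*2 * l)%:R)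
    ('C(n.*2, n)%:R + p%:R * ('C(n.*2, n)%:R + (-1) ^+ n * half_alt_sum n / 2
       + 'C(n.*2, n)%:R^-1)).
Proof.
pose G l : rat := 'C(p * n.*2, n + n.*2 * l)%:R.
have : \sum_(l < p) G l = G n.*2 + 2 * \sum_(l < n.*2) G l.
  have := @sum_symmetric G n.*2; rewrite -pm; apply => l ln; congr (_%:R).
  rewrite -[in LHS]bin_sub; last by nia.
  by congr 'C(_, _); nia.
rewrite sum_pairs {}/G => ->.
rewrite (_ : (n + n.*2 * n.*2 = p * n)%N); last by nia.
apply: eqmD; first exact: bin_mul_mul_eqm.
apply: (@eqm_trans _ _ (p%:R * (- (2 * n.*2%:R) * ((-1) ^+ n *
  ((\sum_(s < n) (-1) ^+ s * 'C(n.*2.-1, s)%:R / (n - s)%:R) +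
   (\sum_(s < n) (-1) ^+ s * 'C(n.*2.-1, s)%:R / (3 * n - s)%:R)))))).
  rewrite -big_split /= !mulr_sumr; apply: eqm_sum => s _; have sn := ltn_ord s.
  rewrite (_ : (n + n.*2 * s.*2 = p * s + (n - s))%N); last by nia.
  rewrite (_ : (n + n.*2 * s.*2.+1 = p * s + (3 * n - s))%N); last by nia.
  have nd : ~~ (p %| n.*2.-1.+1)%N by rewrite mE ndvd //; lia.
  have h1 := @bin_off_eqm p pp n.*2.-1 s (n - s) nd.
  have h2 := @bin_off_eqm p pp n.*2.-1 s (3 * n - s) nd.
  rewrite mE in h1 h2.
  have := eqmMl (plocal_nat p 2) (eqmD (h1 _) (h2 _)).
  have S1 : (-1) ^+ (n - s) = (-1) ^+ n * (-1) ^+ s :> rat.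
    by rewrite -exprD -signr_odd oddB -?oddD ?signr_odd // ltnW.
  have S2 : (-1) ^+ (3 * n - s) = (-1) ^+ n * (-1) ^+ s :> rat.
    rewrite -exprD -signr_odd oddB; last by lia.
    by rewrite oddM /= -oddD signr_odd.
  rewrite S1 S2 => H; apply: eqm_trans (H _ _) _; [lia | lia |].
  apply/eqm_exP => //; exists 0; rewrite ?rpred0 //=; ring.
apply: eqm_pM => //; rewrite half_alt_sum_pred.
have WL := half_alt_sum_plocal.
have n0' : n%:R != 0 :> rat by rewrite pnatr_eq0 -lt0n.
have nV : (n%:R : rat)^-1 \in plocal p by rewrite plocalVn // ndvd //; lia.
set W := half_alt_sum n in WL *; set Y := \sum_(s < n) _.
have YE : eqm p 1 Y ((-1) ^+ n / 'C(n.*2, n)%:R) := far_sum_eqm.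
have CV1 := CV; set C : rat := 'C(n.*2, n)%:R in CV1 YE *.
have CL : C \in plocal p by apply: plocal_nat.
have sq : (-1) ^+ n * (-1) ^+ n = 1 :> rat by rewrite -expr2 sqrr_sign.
(* The prefactor -2(2n) equals 1-p, so it drops out modulo [p]; likewise -C/(4n) becomes C below. *)
apply: (@eqm_trans _ _ ((-1) ^+ n * (- ((-1) ^+ n * C / (4 * n%:R)) + W / 2 + (-1) ^+ n / C))).
  rewrite -[X in eqm _ _ _ X]mul1r.
  have YL : Y \in plocal p by apply: eqm_plocal YE _ => //; apply: rpredM.
  have fourV : (4 * n%:R)^-1 \in plocal p.
    by rewrite -natrM plocalVn // ndvd //; lia.
  apply: eqmM; first apply: rpredM => //.
  - apply: rpredD => //; apply: rpredD; last exact: rpredM.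
    by rewrite rpredN; apply: rpredM => //; apply: rpredM.
  - exact: rpred1.
  - apply/eqm_exP => //; exists (-1); first by rewrite rpredN1.
    by rewrite expn1 pQ -[n.*2]mul2n natrM; ring.
  by apply: eqmMl => //; apply: eqmD => //; apply: eqm_refl.
have -> : (-1) ^+ n * (- ((-1) ^+ n * C / (4 * n%:R)) + W / 2 + (-1) ^+ n / C) =
   (- (C / (4 * n%:R)) + (-1) ^+ n * W / 2 + C^-1).
  rewrite !mulrDr mulrN !mulrA sq !mul1r; congr (_ + _ + _).
apply: eqmD; last exact: eqm_refl.
apply: eqmD; last exact: eqm_refl.
apply/eqm_exP => //; exists (- (C / (n%:R * 2 * 2))).
  by rewrite rpredN rpredM // !invfM !rpredM.
by rewrite expn1 pQ; field; rewrite n0'.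
Qed.

End JacobiExpansion.

(** * Jacobsthal sums *)

(** Since a^2 d^2 - c^2 b^2 = p (d^2 - b^2), [p] divides ad-cb after possibly negating [d]. With
    ad-cb = qp, Brahmagupta's identity p^2 = (ac+bd)^2 + (ad-cb)^2 forces q^2 <= 1. The case q = 0
    gives a^2 = c^2, and q^2 = 1 gives c^2 = b^2, against parity. *)
Lemma two_squares_unique (p : nat) (a b c d : int) : prime p ->
  p%:Z = a ^+ 2 + b ^+ 2 -> p%:Z = c ^+ 2 + d ^+ 2 ->
  (a %% 2)%Z = 1 -> (b %% 2)%Z = 0 -> (c %% 2)%Z = 1 -> a ^+ 2 = c ^+ 2.
Proof.
move=> pp E1 E2 ao be co.
have p0 : p%:Z != 0 by rewrite eqz_nat -lt0n prime_gt0.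
have key (d' : int) : p%:Z = c ^+ 2 + d' ^+ 2 -> (p%:Z %| a * d' - c * b)%Z -> a ^+ 2 = c ^+ 2.
  move=> E2' /dvdzP[q Eq].
  have E3 : p%:Z ^+ 2 = (a * c + b * d') ^+ 2 + (q * p%:Z) ^+ 2.
    by rewrite -Eq expr2 {1}E1 E2'; ring.
  have q1 : q ^+ 2 <= 1.
    rewrite -(@ler_pM2r _ (p%:Z ^+ 2)) ?exprn_gt0 ?ltz_nat ?prime_gt0 // mul1r -exprMn E3.
    by rewrite lerDr sqr_ge0.
  have [q0|q0] := eqVneq q 0.
    apply: (mulIf p0); rewrite {1}E2' {1}E1.
    have e : a * d' = c * b by apply/eqP; rewrite -subr_eq0 Eq q0 mul0r.
    have -> : a ^+ 2 * (c ^+ 2 + d' ^+ 2) = (a * c) ^+ 2 + (a * d') ^+ 2 by ring.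
    by rewrite e; ring.
  have q2 : q ^+ 2 = 1 by apply/eqP; rewrite eq_le q1 -gtz0_ge1 exprn_even_gt0.
  have e : a * c + b * d' = 0.
    apply/eqP; rewrite -sqrf_eq0; apply/eqP/(addIr (p%:Z ^+ 2)).
    by rewrite add0r {2}E3 exprMn q2 mul1r.
  have cb : c ^+ 2 = b ^+ 2.
    apply: (mulIf p0); rewrite {1}E1 {1}E2'.
    have e' : a * c = - (b * d') by apply/eqP; rewrite -addr_eq0 e.
    have -> : c ^+ 2 * (a ^+ 2 + b ^+ 2) = (a * c) ^+ 2 + (c * b) ^+ 2 by ring.
    by rewrite e'; ring.
  have := congr1 (fun z => (z %% 2)%Z) cb.
  by rewrite -(modzXm 2 c) co -(modzXm 2 b) be.
have : (p%:Z %| (a * d - c * b) * (a * d + c * b))%Z.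
  apply/dvdzP; exists (d ^+ 2 - b ^+ 2).
  have -> : (a * d - c * b) * (a * d + c * b) = a ^+ 2 * d ^+ 2 - c ^+ 2 * b ^+ 2 by ring.
  have -> : a ^+ 2 = p%:Z - b ^+ 2 by rewrite E1; ring.
  have -> : c ^+ 2 = p%:Z - d ^+ 2 by rewrite E2; ring.
  by ring.
rewrite !dvdzE abszM Euclid_dvdM // => /orP[] h; first exact: (key d).
by apply: (key (- d)); rewrite ?sqrrN // dvdzE /= mulrN -opprD abszN.
Qed.

Section Jacobsthal.
Variables (p n : nat) (pp : prime p) (pE : p = (4 * n).+1).

Let n0 : (0 < n)%N.
Proof. by rewrite lt0n; apply: contraTneq pp => n0; rewrite pE n0. Qed.

Let cardF : #|'F_p| = p.
Proof. exact: card_Fp. Qed.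

Let natF0 k : (k%:R == 0 :> 'F_p) = (p %| k)%N.
Proof. by rewrite -(dvdn_pcharf (pchar_Fp pp)). Qed.

Let two0 : 2 != 0 :> 'F_p.
Proof. by rewrite natF0 gtnNdvd //; lia. Qed.

Lemma Fp_expf (x : 'F_p) : x != 0 -> x ^+ (4 * n) = 1.
Proof.
move=> x0; apply: (mulfI x0); rewrite mulr1 -exprS -pE.
by have := expf_card x; rewrite cardF.
Qed.

Lemma Fp_primitive_root : exists g : 'F_p, (4 * n).-primitive_root g.
Proof.
pose rs := [seq x <- enum 'F_p | x != 0].
have : has (4 * n).-primitive_root rs.
  apply: has_prim_root; first by rewrite muln_gt0.
  - by apply/allP => x; rewrite mem_filter => /andP[x0 _]; rewrite unity_rootE Fp_expf.
  - by rewrite filter_uniq ?enum_uniq.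
  have e : (1 + size rs = p)%N.
    have := count_predC (pred1 (0 : 'F_p)) (enum 'F_p).
    by rewrite -cardE cardF count_uniq_mem ?enum_uniq // mem_enum size_filter.
  by apply/eq_leq/succn_inj; rewrite -pE -[RHS]add1n e.
by case/hasP => g _; exists g.
Qed.

(** The Legendre symbol through Euler's criterion, as 2n = (p-1)/2. Integer values make the
    character sums genuine integers, reducible modulo 8 as well as p^2. *)
Definition quad_char (x : 'F_p) : int :=
  if x == 0 then 0 else if x ^+ n.*2 == 1 then 1 else -1.

Notation qc := quad_char.

Lemma quad_char0 : qc 0 = 0. Proof. by rewrite /qc eqxx. Qed.

Lemma quad_char1 : qc 1 = 1. Proof. by rewrite /qc oner_eq0 expr1n eqxx. Qed.

Lemma quad_char_exp (x : 'F_p) : (qc x)%:~R = x ^+ n.*2.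
Proof.
rewrite /qc; have [->|x0] := eqVneq x 0; first by rewrite expr0n double_eq0 eqn0Ngt n0.
case: eqP => [->//|/eqP h]; have := Fp_expf x0.
rewrite (_ : (4 * n = n.*2 * 2)%N); last by lia.
by rewrite exprM => /eqP; rewrite sqrf_eq1 (negPf h) /= => /eqP ->.
Qed.

(** Two such values differ by at most 2 < p, so identities of characters can be checked on powers in
    ['F_p]. *)
Let qc_inj (u v : int) : u \in [:: -1; 0; 1] -> v \in [:: -1; 0; 1] ->
  u%:~R = v%:~R :> 'F_p -> u = v.
Proof.
have z0 (z : int) : (`|z| < p)%N -> z%:~R = 0 :> 'F_p -> z = 0.
  case: z => k /= kp /eqP; last first.
    by rewrite NegzE rmorphN /= oppr_eq0 (natF0 k.+1) gtnNdvd.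
  by rewrite (natF0 k); case: k kp => // k kp; rewrite gtnNdvd.
move=> hu hv e; apply/eqP; rewrite -subr_eq0; apply/eqP/z0; last by rewrite rmorphB /= e subrr.
by move: hu hv; rewrite !inE => /or3P[] /eqP -> /or3P[] /eqP -> /=; lia.
Qed.

Let qc_in x : qc x \in [:: -1; 0; 1].
Proof. by rewrite /qc; case: eqP => // _; case: eqP. Qed.

Lemma quad_charM (x y : 'F_p) : qc (x * y) = qc x * qc y.
Proof.
apply: qc_inj; rewrite ?qc_in //; last by rewrite rmorphM /= !quad_char_exp exprMn.
by move: (qc_in x) (qc_in y); rewrite !inE => /or3P[] /eqP -> /or3P[] /eqP ->.
Qed.

Lemma quad_char_sq (x : 'F_p) : x != 0 -> qc x * qc x = 1.
Proof. by rewrite /qc => /negPf ->; case: eqP. Qed.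

Lemma quad_charX2 (x : 'F_p) : x != 0 -> qc (x ^+ 2) = 1.
Proof. by move=> x0; rewrite expr2 quad_charM quad_char_sq. Qed.

Lemma quad_charV (x : 'F_p) : x != 0 -> qc x^-1 = qc x.
Proof.
move=> x0; have := quad_charM x x^-1; rewrite mulfV // quad_char1 => e.
by rewrite -[LHS]mul1r -(quad_char_sq x0) -mulrA -e mulr1.
Qed.

Lemma quad_charN (x : 'F_p) : qc (- x) = qc x.
Proof.
apply: qc_inj; rewrite ?qc_in // !quad_char_exp exprNn -signr_odd odd_double.
by rewrite mul1r.
Qed.

Variables (g : 'F_p) (gP : (4 * n).-primitive_root g).

Let g0 : g != 0.
Proof.
apply/negP => /eqP g0; have := prim_expr_order gP; rewrite g0 expr0n muln_eq0 /= eqn0Ngt n0 /=.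
by move/eqP; rewrite eq_sym oner_eq0.
Qed.

Lemma quad_char_gen : qc g = -1.
Proof.
rewrite /qc (negPf g0); case: eqP => // /eqP; rewrite -(prim_order_dvd gP).
by move/dvdn_leq; rewrite double_gt0 n0 => /(_ isT); lia.
Qed.

Lemma square_or_gen_square (r : 'F_p) : r != 0 ->
  exists2 k, k != 0 & r = k ^+ 2 \/ r = g * k ^+ 2.
Proof.
move/Fp_expf/(prim_rootP gP) => [i ->]; exists (g ^+ (i./2)); first by rewrite expf_neq0.
rewrite -exprM muln2 -exprS -{1 3}(odd_double_half i).
by case: (odd i); [right | left].
Qed.

Lemma quad_char_sum : \sum_x qc x = 0.
Proof.
have : \sum_x qc x = - \sum_x qc x.
  rewrite {1}(reindex_inj (mulfI g0)) /= -sumrN; apply: eq_bigr => x _.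
  by rewrite quad_charM quad_char_gen mulN1r.
lia.
Qed.

Lemma quad_char_sqr_sum : \sum_x qc x * qc x = (4 * n)%:Z.
Proof.
rewrite (bigD1 0) //= quad_char0 mul0r add0r.
rewrite (eq_bigr (fun=> 1)) => [|x x0]; last exact: quad_char_sq.
rewrite sumr_const; have := cardC1 (0 : 'F_p); rewrite cardF pE /= => e.
by rewrite (eq_card (B := predC1 0)) // e natz.
Qed.

(** For u != v put s = u-r and c = v-u: the term is qc(1 + c/s) for s != 0, and 1 + c/s runs over
    everything except 1. The total character sum 0 thus loses qc 1 = 1. *)
Lemma quad_char_corr (u v : 'F_p) :
  \sum_r qc (u - r) * qc (v - r) = if u == v then (4 * n)%:Z else -1.
Proof.
case: eqP => [->|/eqP uv].
  rewrite -quad_char_sqr_sum (reindex_inj (inv_inj (subKr v))) /=.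
  by apply: eq_bigr => r _; rewrite subKr.
have c0 : v - u != 0 by rewrite subr_eq0 eq_sym.
rewrite (reindex_inj (inv_inj (subKr u))) /=.
rewrite (eq_bigr (fun s => qc s * qc (s + (v - u)))); last first.
  by move=> s _; rewrite subKr; congr (_ * qc _); ring.
rewrite (bigD1 0) //= quad_char0 mul0r add0r.
rewrite (eq_bigr (fun s => qc (1 + (v - u) * s^-1))); last first.
  move=> s s0; rewrite (_ : s + (v - u) = s * (1 + (v - u) * s^-1)); last by field.
  by rewrite quad_charM mulrA quad_char_sq // mul1r.
rewrite (reindex_inj invr_inj) /= (eq_bigl (fun s => s != 0)); last by move=> s; rewrite invr_eq0.
rewrite (eq_bigr (fun s => qc (1 + (v - u) * s))); last by move=> s _; rewrite invrK.
have := quad_char_sum; rewrite (reindex_inj (addrI 1)) /= (reindex_inj (mulfI c0)) /=.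
by rewrite (bigD1 0) //= mulr0 addr0 quad_char1 addrC => /eqP; rewrite addr_eq0 => /eqP.
Qed.

(** Up to sign, the trace of Frobenius of y^2 = x^3 - r x. The factor [qc x] stays apart so that
    sums over [r] become correlations. *)
Definition jacobsthal (r : 'F_p) : int := \sum_x qc x * qc (x ^+ 2 - r).

Notation A := jacobsthal.

Lemma jacobsthal_scale (k r : 'F_p) : k != 0 -> A (r * k ^+ 2) = qc k * A r.
Proof.
move=> k0; rewrite /A (reindex_inj (mulfI k0)) mulr_sumr; apply: eq_bigr => x _ /=.
rewrite (_ : (k * x) ^+ 2 - r * k ^+ 2 = k ^+ 2 * (x ^+ 2 - r)); last by ring.
by rewrite (quad_charM k x) (quad_charM (k ^+ 2)) quad_charX2 //; ring.
Qed.

Lemma jacobsthal0 : A 0 = 0.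
Proof.
rewrite -[RHS]quad_char_sum; apply: eq_bigr => x _; rewrite subr0.
by have [->|x0] := eqVneq x 0; rewrite ?quad_char0 ?mul0r // quad_charX2 // mulr1.
Qed.

(** Expand the square and sum over [r] first: the correlation is p [x^2 = y^2] - 1. The -1 dies
    against the vanishing sum of [qc y]; the rest keeps y = x and y = -x, which have equal
    character. *)
Lemma jacobsthal_sqr_sum : \sum_r A r ^+ 2 = 2 * p%:Z * (4 * n)%:Z.
Proof.
have -> : \sum_r A r ^+ 2 =
    \sum_x \sum_y qc x * qc y * \sum_r qc (x ^+ 2 - r) * qc (y ^+ 2 - r).
  rewrite (eq_bigr (fun r => \sum_x \sum_y
     qc x * qc y * (qc (x ^+ 2 - r) * qc (y ^+ 2 - r)))); last first.
    move=> r _; rewrite expr2 /A mulr_suml; apply: eq_bigr => x _.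
    by rewrite mulr_sumr; apply: eq_bigr => y _; ring.
  rewrite exchange_big /=; apply: eq_bigr => x _; rewrite exchange_big /=.
  by apply: eq_bigr => y _; rewrite mulr_sumr.
have -> : \sum_x \sum_y qc x * qc y * \sum_r qc (x ^+ 2 - r) * qc (y ^+ 2 - r) =
   \sum_x (p%:Z * (2 * (qc x * qc x)) - qc x * \sum_y qc y).
  apply: eq_bigr => x _.
  have [->|x0] := eqVneq x 0.
    by rewrite big1 => [|y _]; rewrite quad_char0 ?mul0r ?mulr0.
  rewrite (eq_bigr (fun y => p%:Z * (qc x * (qc y * (x ^+ 2 == y ^+ 2)%:R)) - qc x * qc y)); last first.
    move=> y _; rewrite quad_char_corr.
    have -> : (4 * n)%:Z = p%:Z - 1 by lia.
    by case: eqP => _ /=; ring.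
  rewrite sumrB -mulr_sumr -mulr_sumr -mulr_sumr; congr (_ * _ - _).
  have xx : - x != x.
    by rewrite eq_sym -addr_eq0 -mulr2n -mulr_natr mulf_neq0.
  rewrite (bigD1 x) //= (bigD1 (- x)) //= big1 => [|y /andP[h1 h2]].
    by rewrite sqrrN eqxx /= quad_charN; ring.
  by rewrite eq_sym eqf_sqr (negPf h1) (negPf h2) mulr0.
rewrite sumrB quad_char_sum (eq_bigr (fun x => 2 * p%:Z * (qc x * qc x))); last by move=> x _; ring.
by rewrite -mulr_sumr quad_char_sqr_sum (eq_bigr (fun=> 0)) ?big1_eq ?subr0 // => x _; rewrite mulr0.
Qed.

(* [A(r)^2] depends only on the quadratic class of [r], so
   [jacobsthal_sqr_sum] is an average of two values. *)
Lemma jacobsthal_sqrD : A 1 ^+ 2 + A g ^+ 2 = 4 * p%:Z.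
Proof.
have E : 2 * \sum_r A r ^+ 2 = (4 * n)%:Z * (A 1 ^+ 2 + A g ^+ 2).
  have -> : (4 * n)%:Z * (A 1 ^+ 2 + A g ^+ 2) =
    \sum_r ((qc r * qc r) * (A 1 ^+ 2 + A g ^+ 2) + qc r * (A 1 ^+ 2 - A g ^+ 2)).
    by rewrite big_split /= -!mulr_suml quad_char_sum quad_char_sqr_sum mul0r addr0.
  rewrite mulr_sumr; apply: eq_bigr => r _.
  have [->|r0] := eqVneq r 0; first by rewrite jacobsthal0 quad_char0; ring.
  have [k k0 [->|->]] := square_or_gen_square r0.
    rewrite quad_charX2 // -[k ^+ 2]mul1r jacobsthal_scale // exprMn (expr2 (qc k)) quad_char_sq //.
    by ring.
  rewrite jacobsthal_scale // exprMn (expr2 (qc k)) quad_char_sq // quad_charM quad_charX2 //.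
  by rewrite quad_char_gen; ring.
move: E; rewrite jacobsthal_sqr_sum => E.
apply: (@mulfI _ (4 * n)%:Z); first by rewrite eqz_nat muln_eq0 /= -lt0n.
by rewrite -E; ring.
Qed.

End Jacobsthal.

(** * The Jacobsthal sum modulo 8 *)

Lemma dvdn_card_fibers (T : finType) (S : eqType) (h : T -> S) (D : {set T}) (d : nat) :
  (forall x, x \in D -> #|[set y in D | h y == h x]| = d) -> (d %| #|D|)%N.
Proof.
move=> H; have [k] := ubnP #|D|; elim: k D H => // k IH D H; rewrite ltnS => Dk.
have [->|[x xD]] := set_0Vmem D; first by rewrite cards0 dvdn0.
rewrite -(cardsID [set y | h y == h x] D).
have e : D :&: [set y | h y == h x] = [set y in D | h y == h x].
  by apply/setP => y; rewrite !inE.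
rewrite e H // dvdn_addr //; apply: IH.
  move=> y; rewrite !inE => /andP[yx yD]; rewrite -(H y yD); apply: eq_card => z.
  rewrite !inE; case: (z \in D); rewrite ?andbF ?andbT //=.
  by case: (eqVneq (h z) (h y)) => [->|]; rewrite ?andbF // yx.
apply: leq_trans Dk; apply: proper_card; rewrite properE subsetDl /=.
by apply/subsetPn; exists x => //; rewrite !inE eqxx.
Qed.

Section JacobsthalMod8.
Variables (p n : nat) (pp : prime p) (pE : p = (4 * n).+1).

Let n0 : (0 < n)%N.
Proof. by rewrite lt0n; apply: contraTneq pp => n0; rewrite pE n0. Qed.

Let natF0 k : (k%:R == 0 :> 'F_p) = (p %| k)%N.
Proof. by rewrite -(dvdn_pcharf (pchar_Fp pp)). Qed.

Let two0 : 2 != 0 :> 'F_p.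
Proof. by rewrite natF0 gtnNdvd //; lia. Qed.

Let opp_neq (x : 'F_p) : x != 0 -> - x != x.
Proof. by move=> x0; rewrite eq_sym -addr_eq0 -mulr2n -mulr_natr mulf_neq0. Qed.

Notation qc := (quad_char n).

Let f (x : 'F_p) := qc x * qc (x ^+ 2 - 1).

Let fN x : f (- x) = f x.
Proof. by rewrite /f (quad_charN pp pE) sqrrN. Qed.

Let fV x : x != 0 -> f x^-1 = f x.
Proof.
move=> x0; rewrite /f (quad_charV pp pE) //.
rewrite (_ : x^-1 ^+ 2 - 1 = - (x^-1 ^+ 2 * (x ^+ 2 - 1))); last by field.
rewrite (quad_charN pp pE) (quad_charM pp pE (x^-1 ^+ 2)) (quad_charX2 pp pE) ?invr_eq0 //.
by rewrite mul1r.
Qed.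

Let i_exists : exists i : 'F_p, i ^+ 2 = -1.
Proof.
have [g gP] := Fp_primitive_root pp pE; exists (g ^+ n); apply/eqP.
rewrite -exprM.
have : (g ^+ (n * 2)) ^+ 2 = 1 by rewrite -exprM -mulnA mulnC (prim_expr_order gP).
move/eqP; rewrite sqrf_eq1 => /orP[|//].
rewrite -(prim_order_dvd gP) => /dvdn_leq; lia.
Qed.

(** Off 0, 1, -1 the value is 1 or -1, so the sum of [f] reduces to counting where [f] is 1. *)
Let f_val x : f x = 2 * (f x == 1)%:R - (x \notin [:: 0; 1; -1])%:R.
Proof.
rewrite /f !inE !negb_or.
have [->|x0] := eqVneq x 0; first by rewrite quad_char0 mul0r.
have [->|x1] := eqVneq x 1; first by rewrite expr1n subrr quad_char0 mulr0.
have [->|x2] := eqVneq x (-1); first by rewrite sqrrN expr1n subrr quad_char0 mulr0.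
have : x ^+ 2 - 1 != 0 by rewrite subr_eq0 sqrf_eq1 negb_or x1 x2.
by rewrite /quad_char (negPf x0) => /negPf ->; do 2 (case: ifP => _).
Qed.

(** The sum is 2N - (p-3), where N counts the x with f x = 1. The two roots of x^2 = -1 are counted,
    since i(i^2-1) = -(1+i)^2; the other solutions form orbits of size 4. So N = 2 modulo 4. *)
Lemma jacobsthal_mod8 : exists z : int, jacobsthal n (1 : 'F_p) = 4 * n%:Z - 2 + 8 * z.
Proof.
have [i iE] := i_exists.
have one0 : (1 : 'F_p) != 0 := oner_neq0 _.
have i0 : i != 0.
  apply: contraNneq one0 => i0; move: iE; rewrite i0 expr0n /= => /eqP.
  by rewrite eq_sym oppr_eq0.
pose D1 := [set x | f x == 1]; pose D := [set x in D1 | x ^+ 2 != -1].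
have fi : f i = 1.
  have i1 : 1 + i != 0.
    apply: contraNneq two0 => h; have e : i = -1 by apply/eqP; rewrite -addr_eq0 addrC h.
    by move: iE; rewrite e sqrrN expr1n => iE'; rewrite -[2]/(1 + 1) {2}iE' subrr.
  rewrite /f iE -(quad_charM pp pE) (_ : i * (-1 - 1) = - (1 + i) ^+ 2).
    by rewrite (quad_charN pp pE) (quad_charX2 pp pE).
  have -> : (1 + i) ^+ 2 = 1 + 2 * i + i ^+ 2 by ring.
  by rewrite iE; ring.
have c1 : #|D1| = (2 + #|D|)%N.
  have -> : D = D1 :\ i :\ - i.
    by apply/setP => y; rewrite !inE -iE eqf_sqr negb_or andbC -!andbA andbCA andbC -!andbA andbC -!andbA.
  by rewrite (cardsD1 i) (cardsD1 (- i) (D1 :\ i)) !inE fi fN fi eqxx opp_neq //= addnA.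
have D0 x : x \in D -> [/\ x != 0, x ^+ 2 != -1, x ^+ 2 != 1 & f x = 1].
  rewrite !inE => /andP[/eqP h1 h2]; split => //.
    by apply: contra_eq_neq h1 => ->; rewrite /f quad_char0 mul0r.
  by apply: contra_eq_neq h1 => h; rewrite /f h subrr quad_char0 mulr0.
have inD x : x ^+ 2 != -1 -> f x = 1 -> x \in D by rewrite !inE => -> ->; rewrite eqxx.
have /dvdnP[k Ek] : (4 %| #|D|)%N.
  apply: (dvdn_card_fibers (h := fun x => x ^+ 2 + x^-1 ^+ 2)) => x xD.
  have [x0 xm1 x1 fx] := D0 x xD.
  (* [f] is invariant under [x |-> - x] and [x |-> x^-1], whose orbits are the
     fibres of [x ^+ 2 + x ^- 2]. *)
  pose s := [:: x; - x; x^-1; - x^-1].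
  have us : uniq s.
    have e1 : x != x^-1 by apply: contra x1 => /eqP h; rewrite expr2 {2}h mulfV.
    have e2 : x != - x^-1 by apply: contra xm1 => /eqP h; rewrite expr2 {2}h mulrN mulfV.
    rewrite /= !inE !negb_or e1 e2 [x == - x]eq_sym opp_neq //= eqr_oppLR e2 eqr_opp e1.
    by rewrite [_ == - _]eq_sym opp_neq ?invr_eq0.
  have xV : x^-1 ^+ 2 != -1.
    by apply: contra xm1 => /eqP h; rewrite -[x ^+ 2]invrK -exprVn h invrN1.
  rewrite -[4%N]/(size s) -(card_uniqP us); apply: eq_card => y; rewrite inE.
  apply/andP/idP => [[yD /eqP yx]|]; last first.
    move=> ys; have : [|| y == x, y == - x, y == x^-1 | y == - x^-1] by move: ys; rewrite !inE.
    by case/or4P => /eqP ->; (split; [apply: inD; rewrite ?sqrrN ?fN ?fV |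
      rewrite ?invrN ?invrK ?sqrrN // ?sqrrN // addrC]).
  have [y0 _ _ _] := D0 y yD.
  have : (y - x) * (y + x) * ((x * y - 1) * (x * y + 1)) = 0.
    rewrite -[RHS](mul0r ((x * y) ^+ 2)) -(subrr (x ^+ 2 + x^-1 ^+ 2)) -{1}yx.
    by field; rewrite x0 y0.
  move/eqP; rewrite !mulf_eq0 subr_eq0 addr_eq0 subr_eq0 addr_eq0 !inE -!orbA => /or4P[] /eqP h.
  - by rewrite h eqxx.
  - by rewrite h eqxx ?orbT.
  - by rewrite (_ : y = x^-1) ?eqxx ?orbT //; apply: (mulfI x0); rewrite h mulfV.
  - by rewrite (_ : y = - x^-1) ?eqxx ?orbT //; apply: (mulfI x0); rewrite h mulrN mulfV.
have ->: jacobsthal n (1 : 'F_p) = \sum_x f x by [].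
rewrite (eq_bigr _ (fun x _ => f_val x)) sumrB -mulr_sumr -!natr_sum.
set s3 : seq 'F_p := [:: 0; 1; -1].
have -> : (\sum_x (f x == 1) = #|D1|)%N.
  by rewrite -sum1_card [RHS]big_mkcond; apply: eq_bigr => x _; rewrite inE; case: eqP.
have e3 : (\sum_(x : 'F_p) (x \notin s3) + 3 = p)%N.
  have u3 : uniq s3.
    by rewrite /s3 /= !inE negb_or eq_sym one0 eq_sym oppr_eq0 one0 eq_sym opp_neq.
  rewrite -[3%N]/(size s3) -(card_uniqP u3) -[RHS](card_Fp pp) addnC.
  rewrite -[RHS](cardC (mem s3)); congr (_ + _)%N.
  by rewrite -sum1_card [RHS]big_mkcond; apply: eq_bigr => x _; rewrite !inE; case: (_ || _).
exists (k%:Z + 1 - n%:Z); rewrite c1 Ek !natz.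
move: e3; set N := (\sum_x _)%N => e3; lia.
Qed.

End JacobsthalMod8.

(** * The Jacobsthal sum modulo p^2 *)

(** Each block of 2n consecutive indices contains exactly one admissible [j], at offset [n]. *)
Lemma sum_arith_prog (R : nmodType) (F : nat -> R) (n q : nat) : (0 < n)%N ->
  \sum_(0 <= j < q * n.*2 | (n.*2 %| n + j)%N) F j = \sum_(l < q) F (n + n.*2 * l)%N.
Proof.
move=> n0; elim: q => [|q IH]; first by rewrite big_ord0 mul0n big_geq.
rewrite big_ord_recr /= -IH mulSn addnC (@big_cat_nat _ _ _ (q * n.*2)) ?leq_addr //=; congr (_ + _).
rewrite -{1}[(q * n.*2)%N]add0n big_addn addKn big_mkord.
have hn : (n < n.*2)%N by rewrite -addnn -{1}[n]addn0 ltn_add2l.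
have e r : (n.*2 %| n + (r + q * n.*2))%N = (n.*2 %| n + r)%N.
  by rewrite addnA dvdn_addl // dvdn_mull.
rewrite (bigD1 (Ordinal hn)) /=; last by rewrite e addnn dvdnn.
rewrite [(n.*2 * q)%N]mulnC big1 ?addr0 // => r; rewrite e => /andP[h1 /eqP h2].
case: h2; apply: val_inj => /=.
case/dvdnP: h1 => k; have := ltn_ord r; case: k => [|[|k]]; lia.
Qed.

Section CharacterSum.
Variables (p n : nat) (pp : prime p) (pE : p = (4 * n).+1).

Let n0 : (0 < n)%N.
Proof. by rewrite lt0n; apply: contraTneq pp => n0; rewrite pE n0. Qed.

Let p2 : (1 < p ^ 2)%N.
Proof. by rewrite -(exp1n 2) ltn_exp2r // prime_gt1. Qed.

Notation F := 'F_p.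
Notation R := 'Z_(p ^ 2).

Let natR0 k : (k%:R == 0 :> R) = (p ^ 2 %| k)%N.
Proof. by rewrite -val_eqE /= val_Zp_nat. Qed.

Lemma intZp_eq0 (z : int) : (z%:~R == 0 :> R) = (p%:Z ^+ 2 %| z)%Z.
Proof.
rewrite dvdzE abszX absz_nat -natR0.
by case: z => k //; rewrite NegzE rmorphN /= oppr_eq0.
Qed.

Lemma intFp_eq0 (z : int) : (z%:~R == 0 :> F) = (p%:Z %| z)%Z.
Proof.
rewrite dvdzE absz_nat (dvdn_pcharf (pchar_Fp pp)).
by case: z => k //; rewrite NegzE rmorphN /= oppr_eq0.
Qed.

Let pp0 : p%:R * p%:R = 0 :> R.
Proof. by rewrite -natrM mulnn; apply/eqP; rewrite natR0. Qed.

(** In the binomial expansion the linear term carries p * p and the higher ones p^2, so a p-th power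
    modulo p^2 depends only on its base modulo [p]. *)
Lemma expp_lift (y z : R) : (y + p%:R * z) ^+ p = y ^+ p.
Proof.
have pe : p = p.-1.+1 by rewrite prednK ?prime_gt0.
rewrite exprDn big_ord_recl subn0 expr0 mulr1 bin0 mulr1n big1 ?addr0 // => i _.
rewrite exprMn lift0.
have [->|i0] := eqVneq (i : nat) 0%N.
  by rewrite bin1 !expr1 -mulr_natr -!mulrA [z * _]mulrC [p%:R * (p%:R * _)]mulrA pp0 mul0r mulr0.
have -> : p%:R ^+ i.+1 = 0 :> R.
  by rewrite -(prednK (_ : 0 < i)%N) ?lt0n // !exprS mulrA pp0 mul0r.
by rewrite mul0r mulr0 mul0rn.
Qed.

(** At precision p^2 a single p-th power of any lift already gives the Teichmueller
    representative. *)
Definition teich (x : F) : R := ((x : nat)%:R) ^+ p.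

Lemma teichE (x : F) (u : int) : u%:~R = x -> teich x = u%:~R ^+ p.
Proof.
move=> ux; have : (p%:Z %| (x : nat)%:Z - u)%Z.
  rewrite -intFp_eq0 rmorphB /= ux subr_eq0; apply/eqP.
  exact: natr_Zp.
case/dvdzP => q e; rewrite /teich -[(x : nat)%:R]/((x : nat)%:Z%:~R).
have -> : (x : nat)%:Z = u + p%:Z * q by rewrite [_ * q]mulrC -e; ring.
by rewrite rmorphD rmorphM /= expp_lift.
Qed.

Let valE (x : F) : ((x : nat)%:Z)%:~R = x.
Proof. exact: natr_Zp. Qed.

Lemma teichM (x y : F) : teich (x * y) = teich x * teich y.
Proof.
rewrite (@teichE (x * y) ((x : nat)%:Z * (y : nat)%:Z)).
  by rewrite rmorphM exprMn.
by rewrite rmorphM /= !valE.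
Qed.

Lemma teich1 : teich 1 = 1.
Proof. by rewrite (@teichE 1 1) ?expr1n. Qed.

Lemma teichX (x : F) k : teich (x ^+ k) = teich x ^+ k.
Proof. by elim: k => [|k IH]; rewrite ?expr0 ?teich1 // !exprS teichM IH. Qed.

(** The values -1, 0, 1 are their own p-th powers, [p] being odd, hence their own Teichmueller
    representatives. *)
Lemma teich_quad_char (x : F) : (quad_char n x)%:~R = teich x ^+ n.*2.
Proof.
rewrite -teichX (teichE (quad_char_exp pp pE x)) /quad_char.
case: ifP => _; first by rewrite expr0n -[(p == 0)%N]negbK -lt0n prime_gt0.
case: ifP => _; first by rewrite expr1n.
by rewrite rmorphN1 -signr_odd pE oddS oddM.
Qed.

(** By Fermat, 1 - (x^p)^2 is another lift of 1 - x^2, and its p-th power is the right-hand side. *)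
Lemma teich_1subX2 (x : F) : teich (1 - x ^+ 2) = (1 - teich x ^+ 2) ^+ p.
Proof.
rewrite (@teichE _ (1 - ((x : nat)%:Z ^+ p) ^+ 2)).
  by rewrite rmorphB rmorph1 !rmorphXn.
rewrite rmorphB rmorph1 !rmorphXn /= valE.
by have := expf_card x; rewrite card_Fp // => ->.
Qed.

(** Orthogonality: replacing x by g x multiplies the sum by teich(g^k). As k > 0, the term x = 0
    vanishes. *)
Lemma teich_power_sum (k : nat) : (0 < k)%N ->
  \sum_x teich x ^+ k = if (4 * n %| k)%N then (4 * n)%:R else 0.
Proof.
have n4 : (4 * n == 0)%N = false by rewrite -[n]prednK.
move=> k0; case: ifP => [/dvdnP[q e]|kn]; last first.
  have [g gP] := Fp_primitive_root pp pE.
  have gk : g ^+ k != 1 by rewrite -(prim_order_dvd gP) kn.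
  have g0 : g != 0.
    by apply: contra_eq_neq (prim_expr_order gP) => ->; rewrite expr0n n4 eq_sym oner_eq0.
  have E : (teich (g ^+ k) - 1) * \sum_x teich x ^+ k = 0.
    rewrite mulrBl mul1r [X in _ - X](reindex_inj (mulfI g0)) mulr_sumr -sumrB big1 // => x _ /=.
    by rewrite teichM exprMn teichX subrr.
  (* [teich (g ^+ k) - 1] is nonzero modulo [p], hence a unit. *)
  have [v Ev] : exists v : R, v * (teich (g ^+ k) - 1) = 1.
    pose z : int := ((g ^+ k : F) : nat)%:Z ^+ p - 1.
    have zE : z%:~R = teich (g ^+ k) - 1 by rewrite rmorphB rmorph1 rmorphXn.
    have : coprimez z (p%:Z ^+ 2).
      rewrite coprimezXr // coprimez_sym coprimezE absz_nat prime_coprime //.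
      rewrite -[(p %| _)%N]/(p%:Z %| z)%Z -intFp_eq0 /z rmorphB rmorph1 rmorphXn /= valE.
      by have := expf_card (g ^+ k); rewrite card_Fp // => ->; rewrite subr_eq0.
    case/coprimezP => -[u w] /= e; exists u%:~R.
    rewrite -zE -rmorphM -[RHS](rmorph1 (intmul 1 : int -> R)) -e rmorphD.
    by rewrite [X in _ = _ + X]rmorphM rmorphXn /= -[p%:~R]/(p%:R) expr2 pp0 mulr0 addr0.
  by rewrite -[LHS]mul1r -Ev -mulrA E mulr0.
rewrite e in k0 *; rewrite (bigD1 0) //= (@teichE 0 0) //.
rewrite expr0n -[(p == 0)%N]negbK -lt0n prime_gt0 // expr0n.
rewrite eqn0Ngt k0 add0r (eq_bigr (fun=> 1)) => [|x x0]; last first.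
  by rewrite mulnC exprM -teichX (Fp_expf pp pE) // teich1 expr1n.
rewrite sumr_const; have := cardC1 (0 : 'F_p); rewrite card_Fp // pE /= => e0.
by rewrite (eq_card (B := predC1 0)) // e0.
Qed.

(** With t = teich x the summand is t^(2n) (1-t^2)^(2np). Expanding, the power sum of exponent 2n+2j
    survives only when 2n divides n+j; such [j] has the parity of [n], which fixes the sign. *)
Lemma jacobsthal_Zp :
  (jacobsthal n (1 : F))%:~R =
  (4 * n)%:R * (-1) ^+ n * \sum_(l < p) 'C(p * n.*2, n + n.*2 * l)%:R :> R.
Proof.
rewrite rmorph_sum /=.
rewrite (eq_bigr (fun x => \sum_(j < (p * n.*2).+1)
    (-1) ^+ j * 'C(p * n.*2, j)%:R * teich x ^+ (n.*2 + j.*2))); last first.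
  move=> x _; rewrite -(quad_charN pp pE (x ^+ 2 - 1)) opprB rmorphM /= !teich_quad_char teich_1subX2.
  rewrite -(exprM (1 - teich x ^+ 2)) exprBn mulr_sumr; apply: eq_bigr => j _.
  by rewrite expr1n mulr1 -mulr_natr -(exprM (teich x) 2) mul2n exprD; ring.
rewrite exchange_big /=.
rewrite (eq_bigr (fun j : 'I_(p * n.*2).+1 => if (n.*2 %| n + j)%N then
   (4 * n)%:R * (-1) ^+ n * 'C(p * n.*2, j)%:R else 0)); last first.
  move=> j _; rewrite -mulr_sumr teich_power_sum; last by rewrite addn_gt0 double_gt0 n0.
  rewrite (_ : (4 * n %| n.*2 + j.*2)%N = (n.*2 %| n + j)%N); last first.
    by rewrite -doubleD -!mul2n (_ : 4 * n = 2 * (2 * n))%N ?dvdn_pmul2l //; lia.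
  case: ifP => [/dvdnP[q e]|_]; last by rewrite mulr0.
  have -> : (-1) ^+ j = (-1) ^+ n :> R.
    rewrite -signr_odd -[RHS]signr_odd; congr (_ ^+ _); have := congr1 odd e.
    by rewrite oddD oddM odd_double andbF; case: (odd n); case: (odd j).
  by ring.
rewrite -(big_mkord xpredT (fun j => if (n.*2 %| n + j)%N then
   (4 * n)%:R * (-1) ^+ n * 'C(p * n.*2, j)%:R else 0)) big_nat_recr //=.
(* The top index j = 2np fails the divisibility since 0 < n < 2n, leaving [p] full blocks. *)
rewrite ifN ?addr0; last first.
  by rewrite dvdn_addl ?dvdn_mull // gtnNdvd // -addnn -{1}[n]addn0 ltn_add2l.
by rewrite -big_mkcond sum_arith_prog // mulr_sumr.
Qed.

Lemma jacobsthal_eqm :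
  eqm p 2 (jacobsthal n (1 : F))%:~R
    ((4 * n)%:R * (-1) ^+ n * \sum_(l < p) 'C(p * n.*2, n + n.*2 * l)%:R).
Proof.
pose z : int := (4 * n)%:R * (-1) ^+ n * \sum_(l < p) 'C(p * n.*2, n + n.*2 * l)%:R.
have zE (S : comNzRingType) : z%:~R =
    (4 * n)%:R * (-1) ^+ n * \sum_(l < p) 'C(p * n.*2, n + n.*2 * l)%:R :> S.
  rewrite !rmorphM /= rmorphXn /= rmorphN1 rmorph_nat rmorph_sum /=; congr (_ * _).
  by apply: eq_bigr => l _; rewrite rmorph_nat.
rewrite -zE; apply: eqm_int => //.
by rewrite -intZp_eq0 rmorphB /= zE jacobsthal_Zp subrr.
Qed.

End CharacterSum.

(** * Identification with a, and conclusion *)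

Lemma jacobsthal_value (p n : nat) (a b : int) : prime p -> p = (4 * n).+1 ->
  p%:Z = a ^+ 2 + b ^+ 2 -> (a %% 4)%Z = 1 ->
  jacobsthal n (1 : 'F_p) = - 2 * (-1) ^+ n * a.
Proof.
move=> pp pE Eab a1.
have [g gP] := Fp_primitive_root pp pE.
have := jacobsthal_sqrD pp pE gP; have [z ->] := jacobsthal_mod8 pp pE.
set c : int := 2 * n%:Z - 1 + 4 * z; set B := jacobsthal n g.
have -> : 4 * n%:Z - 2 + 8 * z = 2 * c by rewrite /c; ring.
move=> E.
(* [B] is even since B^2 = 4p - 4c^2; halving both sums gives p = c^2 + d^2 with [c] odd. *)
have B2 : (B %% 2)%Z = 0.
  have : ((B * B) %% 2)%Z = 0 by move: E; rewrite !expr2; lia.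
  have [//|h] : (B %% 2)%Z = 0 \/ (B %% 2)%Z = 1 by lia.
  by rewrite -modzMml -modzMmr h.
have [d Bd] : exists d, B = 2 * d by exists (B %/ 2)%Z; lia.
have Ecd : p%:Z = c ^+ 2 + d ^+ 2.
  by move: E; rewrite Bd !expr2; lia.
have a2 : (a %% 2)%Z = 1 by lia.
have b2 : (b %% 2)%Z = 0.
  have [//|h] : (b %% 2)%Z = 0 \/ (b %% 2)%Z = 1 by lia.
  have : ((a ^+ 2 + b ^+ 2) %% 2)%Z = 0.
    by rewrite -modzDml -modzDmr -(modzXm 2 a) a2 -(modzXm 2 b) h.
  by rewrite -Eab; lia.
have c2 : (c %% 2)%Z = 1 by rewrite /c; lia.
(* Uniqueness gives a = c or a = -c; c = 2n-1 and a = 1 modulo 4 then decide the sign by the parity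
   of [n]. *)
have /eqP := two_squares_unique pp Eab Ecd a2 b2 c2; rewrite eqf_sqr.
have -> : (-1) ^+ n = if odd n then -1 else 1 :> int by rewrite -signr_odd; case: odd.
by case: ifP => on /orP[] /eqP; move: on a1; rewrite /c; clear => *; lia.
Qed.

(** Equate the two evaluations of the Jacobsthal sum: the factor -4n = 1-p removes the term p 'C(2n,
    n) of [jacobi_sum_eqm]. Modulo [p] this is Gauss's congruence for 'C(2n, n). *)
Lemma bin_mid_eqm (p n : nat) (a b : int) : prime p -> p = (4 * n).+1 ->
  p%:Z = a ^+ 2 + b ^+ 2 -> (a %% 4)%Z = 1 ->
  eqm p 2 (2 * a%:~R) ('C(n.*2, n)%:R +
     p%:R * ((-1) ^+ n * half_alt_sum n / 2 + 'C(n.*2, n)%:R^-1)).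
Proof.
move=> pp pE Eab a1.
have sq : (-1) ^+ n * (-1) ^+ n = 1 :> rat by rewrite -expr2 sqrr_sign.
have sL : - (-1) ^+ n \in plocal p by rewrite rpredN rpredX // rpredN1.
have := jacobsthal_eqm pp pE; rewrite (jacobsthal_value pp pE Eab a1).
move/(eqmMl sL).
have -> : - (-1) ^+ n * (- 2 * (-1) ^+ n * a)%:~R = 2 * a%:~R :> rat.
  rewrite !rmorphM rmorphN rmorphXn rmorphN1 /=.
  rewrite [LHS](_ : _ = 2 * ((-1) ^+ n * (-1) ^+ n) * a%:~R); last by ring.
  by rewrite sq mulr1.
set T := \sum_(l < p) _.
have -> : - (-1) ^+ n * ((4 * n)%:R * (-1) ^+ n * T) = - (4 * n)%:R * T.
  rewrite [LHS](_ : _ = - ((-1) ^+ n * (-1) ^+ n) * ((4 * n)%:R * T)); last by ring.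
  by rewrite sq; ring.
move=> H; apply: eqm_trans H _.
have nL : - (4 * n)%:R \in plocal p by rewrite rpredN plocal_nat.
apply: eqm_trans (eqmMl nL (jacobi_sum_eqm pp pE)) _.
have nd := ndvd_bin_mid pp pE.
have CV : ('C(n.*2, n)%:R : rat)^-1 \in plocal p by rewrite plocalVn.
have WL := half_alt_sum_plocal pp pE.
have halfV : (2 : rat)^-1 \in plocal p.
  by rewrite plocalVn // gtnNdvd //; have := prime_gt1 pp; lia.
apply/eqm_exP => //; exists (- ('C(n.*2, n)%:R + (-1) ^+ n * half_alt_sum n / 2 + 'C(n.*2, n)%:R^-1)).
  rewrite rpredN; apply: rpredD => //; apply: rpredD; first exact: plocal_nat.
  by apply: rpredM => //; apply: rpredM => //; rewrite -rpredN.
have -> : (4 * n)%:R = p%:R - 1 :> rat by rewrite pE -natr1 addrK.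
by rewrite natrX; ring.
Qed.

Unset Implicit Arguments.

Theorem theorem2p10 (p : nat) (a b : int) :
  prime p -> (p %% 4 = 1)%N ->
  p%:Z = a ^+ 2 + b ^+ 2 -> (a %% 4)%Z = 1 ->
  rat_eqmod p 2
    (\sum_(0 <= k < (p - 1) %/ 4 + 1)
        ('C(4 * k, 2 * k) ^ 2)%N%:R / (16 ^ (2 * k))%N%:R)
    (1 / 2 + (-1) ^+ ((p - 1) %/ 4) * a%:~R
       - (-1) ^+ ((p - 1) %/ 4) * (p%:R / (4 * a%:~R))).
Proof.
move=> pp p4 Eab a1; apply: eqm_rat_eqmod => //.
set n := ((p - 1) %/ 4)%N.
have pE : p = (4 * n).+1 by rewrite /n; have := prime_gt0 pp; lia.
have sL : (-1) ^+ n \in plocal p by rewrite rpredX // rpredN1.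
have sq : (-1) ^+ n * (-1) ^+ n = 1 :> rat by rewrite -expr2 sqrr_sign.
have halfV : (2 : rat)^-1 \in plocal p.
  by rewrite plocalVn // gtnNdvd //; have := prime_gt1 pp; lia.
have nd := ndvd_bin_mid pp pE.
have CV : ('C(n.*2, n)%:R : rat)^-1 \in plocal p by rewrite plocalVn.
have C0 : 'C(n.*2, n)%:R != 0 :> rat by rewrite pnatr_eq0; apply: contraNneq nd => ->.
have H2a := bin_mid_eqm pp pE Eab a1.
have WL := half_alt_sum_plocal pp pE.
have HC : eqm p 1 (2 * a%:~R) 'C(n.*2, n)%:R.
  apply: eqm_trans (eqmW pp H2a) _; apply/eqm_exP => //; eexists; last by rewrite expn1.
  by apply: rpredD => //; apply: rpredM => //; apply: rpredM.
have a0 : a%:~R != 0 :> rat by rewrite intr_eq0; apply/eqP => a0; rewrite a0 in a1.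
(* By [HC] a factor [p] of 2a would divide 'C(2n, n). The sign of [a] is split off to work with a
   natural number. *)
have aV : (2 * a%:~R : rat)^-1 \in plocal p.
  have e : 2 * a%:~R = (-1) ^+ (a < 0)%R * (2 * `|a|)%N%:R :> rat.
    by rewrite natrM {1}[a]intEsign rmorphM rmorphXn rmorphN1 /=; ring.
  rewrite e invfM rpredM //; first by rewrite -exprVn invrN1 rpredX // rpredN1.
  rewrite plocalVn //; apply: contra nd => /dvdnP[q Eq].
  apply: (eqm1_dvd pp); apply: eqm_trans (eqm_sym HC) _; rewrite e Eq.
  apply/eqm_exP => //; exists ((-1) ^+ (a < 0)%R * q%:R).
    by rewrite rpredM ?plocal_nat // rpredX // rpredN1.
  by rewrite expn1 natrM; ring.
have HV : eqm p 1 'C(n.*2, n)%:R^-1 (2 * a%:~R)^-1.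
  by apply: eqmV => //; [rewrite mulf_neq0 | apply: eqm_sym].
apply: eqm_trans (truncated_sum_eqm pp pE) _.
rewrite -addrA; apply: eqmD; first exact: eqm_refl.
have -> : (-1) ^+ n * a%:~R - (-1) ^+ n * (p%:R / (4 * a%:~R)) =
   ((-1) ^+ n * (2 * a%:~R - p%:R * (2 * a%:~R)^-1)) / 2 :> rat by field; rewrite a0.
apply: eqmMr => //; apply: eqm_trans (delannoy_eqm pp pE) _.
(* Adding and subtracting p/C exposes the right-hand side of [bin_mid_eqm], which absorbs
   [half_alt_sum]. What remains is 2a - p/C, and [HV] replaces C by 2a under the factor [p]. *)
have -> : (-1) ^+ n * 'C(n.*2, n)%:R + p%:R * (half_alt_sum n / 2) =
  (-1) ^+ n * ('C(n.*2, n)%:R + p%:R * ((-1) ^+ n * half_alt_sum n / 2 + 'C(n.*2, n)%:R^-1)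
     - p%:R * 'C(n.*2, n)%:R^-1) :> rat.
  rewrite [RHS](_ : _ = (-1) ^+ n * 'C(n.*2, n)%:R +
     ((-1) ^+ n * (-1) ^+ n) * (p%:R * (half_alt_sum n / 2))); last by ring.
  by rewrite sq mul1r.
apply: eqmMl => //; apply: eqmB; first exact: eqm_sym.
exact: eqm_pM.
Qed.
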